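(* For each increasing unbounded function $\varphi \colon \mathbb N \to [0,\infty)$, each $\Delta\in \mathbb{N}$ with $\Delta\geq 3$, and each $\lambda^\star>\lambda_c(\Delta)$, there exists a family of graphs $\mathcal{G}$ of maximum degree at most $\Delta$ such that $\mathcal{G}$ satisfies VSSM from distance $\varphi$ at every $\lambda\in [0,\lambda^\star]$, and such that there exist a sequence of graphs $(G_n)_n$ in $\mathcal{G}$ and a sequence $(\lambda_n)_n$ in $\mathbb{C}$ such that $Z_{G_n}(\lambda_n)=0$ for all $n$ and $\lambda_n\to \lambda_c(\Delta)$.
   Context: All graphs are finite and simple; $\mathbb N=\{1,2,\dots\}$. $\lambda_c(\Delta)=\frac{(\Delta-1)^{\Delta-1}}{(\Delta-2)^\Delta}$. For a graph $G=(V,E)$, $\mathcal I_G$ is the collection of independent sets of $G$ and $Z_G(\lambda)=\sum_{I\in\mathcal I_G}\lambda^{|I|}$. For $v\in V$ and $\ell\in\mathbb N$, $S_G(v,\ell)$ is the set of vertices at distance exactly $\ell$ from $v$ in $G$. Boundary conditions and ratios: a boundary condition on $G$ is a map $\sigma:V_\sigma\to\{0,1\}$ with $V_\sigma\subset V$ such that $V_{\sigma,\mathrm{in}}:=\sigma^{-1}(1)$ is independent in $G$. For $v\in V\setminus V_\sigma$ put $$Z^{v\,\mathrm{in}}_{(G,\sigma)}(\lambda)=\sum_{\substack{v\in I\subseteq V\setminus V_\sigma\\ I\cup V_{\sigma,\mathrm{in}}\in\mathcal I_G}}\lambda^{|I|},\qquad Z^{v\,\mathrm{out}}_{(G,\sigma)}(\lambda)=\sum_{\substack{v\notin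 I\subseteq V\setminus V_\sigma\\ I\cup V_{\sigma,\mathrm{in}}\in\mathcal I_G}}\lambda^{|I|},\qquad R_{(G,\sigma),v}(\lambda)=\frac{Z^{v\,\mathrm{in}}_{(G,\sigma)}(\lambda)}{Z^{v\,\mathrm{out}}_{(G,\sigma)}(\lambda)}.$$ Tree of self avoiding walks: fix a total ordering of the vertices of $G$ (inherited by induced subgraphs). For a vertex $v$ of $G$ the rooted tree $T_{\mathrm{SAW}(G,v)}$ (with root $v$) is defined recursively. If the component of $G$ containing $v$ is $\{v\}$, then $T_{\mathrm{SAW}(G,v)}$ is the single vertex $v$. Otherwise let $v_1,\dots,v_d$ be the neighbours of $v$ in $G$ (listed in increasing order), let $G_i$ be obtained from $G$ by removing $v,v_1,\dots,v_{i-1}$, and let $T_i=T_{\mathrm{SAW}(G_i,v_i)}$; then $T_{\mathrm{SAW}(G,v)}$ is obtained from the disjoint union of $T_1,\dots,T_d$ by adding a root vertex $v$ joined to the root $v_i$ of each $T_i$. VSSM from distance $\varphi$: the hard-core model on a family $\mathcal G$ of bounded degree graphs satisfies VSSM from distance $\varphi$ at $\lambda\ge 0$ if there exist constants $\alpha\in[0,1)$ and $C>0$ such that for all $G=(V,E)\in\mathcal G$, every induced subgraph $H$ of $G$, every $v\in V(H)$, every $\ell\in\mathbb N$ with $\ell\ge\varphi(|V|)$, and all boundary conditions $\sigma,\tau:S_{T}(v,\ell)\to\{0,1\}$ with $T=T_{\mathrm{SAW}(H,v)}$, we have $|R_{(T,\sigma),v}(\lambda)-R_{(T,\tau),v}(\lambda)|\le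 C\alpha^\ell$. *)

(* Defs.v *)
From mathcomp Require Import all_boot all_order all_algebra.
From mathcomp Require Import all_classical all_reals all_analysis.
From mathcomp Require Import complex.
Set Implicit Arguments.
Unset Strict Implicit.
Unset Printing Implicit Defensive.
Import Order.TTheory GRing.Theory Num.Theory.
Import numFieldNormedType.Exports.
Local Open Scope ring_scope.

Record graph := Graph {
  vertex :> finType;
  adj : rel vertex;
  adj_sym : symmetric adj;
  adj_irr : irreflexive adj }.

Definition max_degree_le (Delta : nat) (G : graph) : Prop :=
  forall x : G, (#|[set y | adj x y]| <= Delta)%N.

Definition independent (G : graph) (I : {set G}) : bool :=
  [forall x in I, forall y in I, ~~ adj x y].

Definition indep_poly (K : comNzRingType) (G : graph) (lambda : K) : K :=
  \sum_(I : {set G} | independent I) lambda ^+ #|I|.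

Definition walk_of_length (G : graph) (k : nat) (x y : G) : bool :=
  [exists p : k.-tuple G, path (@adj G) x p && (last x p == y)].

Definition sphere (G : graph) (v : G) (l : nat) : {set G} :=
  [set x | walk_of_length l v x & [forall k : 'I_l, ~~ walk_of_length k v x]].

(* A map from a subset of the vertices to {0,1} is encoded as a partial        *)
(* function: None outside the domain, Some true for the value 1.               *)
Definition bc_dom (G : graph) (sigma : {ffun G -> option bool}) : {set G} :=
  [set x | sigma x != None].

Definition bc_in (G : graph) (sigma : {ffun G -> option bool}) : {set G} :=
  [set x | sigma x == Some true].

Definition boundary_condition (G : graph) (sigma : {ffun G -> option bool}) :
    bool :=
  independent (bc_in sigma).

Definition Z_in (K : comNzRingType) (G : graph)
    (sigma : {ffun G -> option bool}) (v : G) (lambda : K) : K :=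
  \sum_(I : {set G} | [&& v \in I, I \subset ~: bc_dom sigma
                        & independent (I :|: bc_in sigma)]) lambda ^+ #|I|.

Definition Z_out (K : comNzRingType) (G : graph)
    (sigma : {ffun G -> option bool}) (v : G) (lambda : K) : K :=
  \sum_(I : {set G} | [&& v \notin I, I \subset ~: bc_dom sigma
                        & independent (I :|: bc_in sigma)]) lambda ^+ #|I|.

Definition ratio (K : fieldType) (G : graph)
    (sigma : {ffun G -> option bool}) (v : G) (lambda : K) : K :=
  Z_in sigma v lambda / Z_out sigma v lambda.

Record rooted_graph := RootedGraph { rgraph :> graph; root : rgraph }.

Section Join.
Variables (d : nat) (T : 'I_d -> rooted_graph).

(* None is the new root; Some (Tagged _ x) is the copy of the vertex x of T i. *)
Definition join_adj (a b : option {i : 'I_d & vertex (T i)}) : bool :=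
  match a, b with
  | None, None => false
  | None, Some w | Some w, None => tagged w == root (T (tag w))
  | Some u, Some w => (tag u == tag w) && adj (tagged u) (tagged_as u w)
  end.

Lemma join_adj_sym : symmetric join_adj.
Proof.
move=> [[i x]|] [[j y]|] //=; have [eq_ij|//] := eqVneq i j.
by case: j / eq_ij y => y; rewrite !tagged_asE adj_sym.
Qed.

Lemma join_adj_irr : irreflexive join_adj.
Proof. by case=> [[i x]|] //=; rewrite eqxx tagged_asE adj_irr. Qed.

Definition join : rooted_graph :=
  @RootedGraph (Graph join_adj_sym join_adj_irr) None.

End Join.

Lemma unit_adj_sym : symmetric (fun _ _ : unit => false).
Proof. by []. Qed.

Lemma unit_adj_irr : irreflexive (fun _ _ : unit => false).
Proof. by []. Qed.

Definition single_vertex : rooted_graph :=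
  @RootedGraph (Graph unit_adj_sym unit_adj_irr) tt.

(* SAW_rec le n U v is the tree of self avoiding walks, starting at v, of the  *)
(* subgraph of G induced by U, as soon as v \in U and #|U| <= n; n only serves *)
(* to make the recursion structural and its base case is then never reached.   *)
(* If v has no neighbour in U, the join below is the single vertex None.       *)
Fixpoint SAW_rec (G : graph) (le : rel G) (n : nat) (U : {set G}) (v : G) :
    rooted_graph :=
  if n is m.+1 then
    let nbrs := sort le (enum [set w in U | adj v w]) in
    join (fun i : 'I_(size nbrs) =>
      SAW_rec le m (U :\: [set w in v :: take i nbrs]) (nth v nbrs i))
  else single_vertex.

Definition SAW_tree (G : graph) (le : rel G) (U : {set G}) (v : G) :
    rooted_graph :=
  SAW_rec le #|U| U v.

Definition total_order (V : Type) (le : rel V) : Prop :=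
  [/\ total le, transitive le & antisymmetric le].

(* The trees of self avoiding walks depend on a total order of the vertices of *)
(* each graph, given here by ord and inherited by the induced subgraphs, which *)
(* are represented by their vertex sets U.                                     *)
Definition VSSM (R : realType) (ord : forall G : graph, rel G)
    (F : graph -> Prop) (phi : nat -> R) (lambda : R) : Prop :=
  exists alpha C : R, [/\ 0 <= alpha, alpha < 1, 0 < C &
    forall G : graph, F G ->
    forall (U : {set G}) (v : G), v \in U ->
    forall l : nat, (0 < l)%N -> phi #|G| <= l%:R ->
    let T := SAW_tree (ord G) U v in
    forall sigma tau : {ffun T -> option bool},
      boundary_condition sigma -> bc_dom sigma = sphere (root T) l ->
      boundary_condition tau -> bc_dom tau = sphere (root T) l ->
      `|ratio sigma (root T) lambda - ratio tau (root T) lambda|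
        <= C * alpha ^+ l].

Definition lambda_c (R : realType) (Delta : nat) : R :=
  (Delta%:R - 1) ^+ (Delta - 1) / (Delta%:R - 2) ^+ Delta.

(* Main.v *)
Require Import Defs.
From mathcomp Require Import all_boot all_order all_algebra.
From mathcomp Require Import all_classical all_reals all_analysis.
From mathcomp Require Import complex.
From mathcomp Require Import zify ring lra.

(** Spatial mixing in the sense of VSSM only constrains spheres of radius at
    least phi #|V|, so it can be made vacuous: adding isolated vertices to a
    graph multiplies its independence polynomial by a power of 1 + lambda, which
    keeps the zeros, and makes phi #|V| exceed the depth of every tree of self
    avoiding walks ([VSSM_far], [padded_family_of_zeros]).  The content is thus
    that graphs of maximum degree d + 1 have zeros arbitrarily close to
    lambda_c = d^d / (d - 1)^(d + 1) ([zeros_near_critical]).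

    The usual argument for this uses normal families and Montel's theorem.  Here
    it is replaced by estimates on the real line; complex numbers enter only
    through the factorisation of polynomials.  Suppose that no such graph has a
    zero within eps of lambda_c.

    For a rooted tree T let R_T be the ratio of the independent sets containing
    the root to those avoiding it.  Joining d copies of T to a new root replaces
    R_T by f(R_T), where f(x) = lambda / (1 + x)^d; the fixed point x of f is
    repelling exactly when lambda > lambda_c.

    Instability.  Some tree T and some lambda_0 slightly above lambda_c satisfy
    R_T(lambda_0) = x(lambda_0), without this being an identity in lambda
    ([crossing_tree]).  Such a T joins d - 1 even iterates and one odd iterate of
    the one-vertex tree to a root.  These iterates converge to the fixed point at
    lambda_c, where f has no 2-cycle ([two_cycle_gt]), and to a genuine 2-cycle
    a < b above lambda_c, where (1 + a)(1 + b) > (1 + x)^2; hence R_T - x changes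
    sign.  Since R_T - f(R_T) vanishes at lambda_0 to finite order only and f is
    expanding near x, some f^i(R_T) with i <= k + 1 leaves a fixed neighbourhood
    of x when lambda_0 is replaced by lambda_0 + theta^k, for a suitable
    theta < 1 ([tree_escape]).

    Stability.  The tree behind f^i(R_T) has N = O(d^i) vertices, and
    ln (1 + f^i(R_T)) is a difference of logarithms of two polynomials of degree
    O(N) without roots within r of lambda_0.  Expanding ln (1 - z / w) for every
    root w shows that it agrees with a polynomial of degree at most j up to
    O(N (z / r)^(j + 1)) ([log_poly]).  It is also bounded on the real line.
    With j fixed and large, a polynomial of degree j bounded on [0, h] has slope
    O(1 / h) at 0, and h may be taken as tau^k with theta < tau < 1 since
    d tau^(j + 1) <= 1 keeps the error bounded.  So the values at lambda_0 and at
    lambda_0 + theta^k differ by O((theta / tau)^k), uniformly in i <= k + 1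
    ([tree_stable]).  This contradicts the instability. *)

Set Implicit Arguments.
Unset Strict Implicit.
Unset Printing Implicit Defensive.
Import Order.TTheory GRing.Theory Num.Theory.
Import numFieldNormedType.Exports.
Import ComplexField.Normc.
Local Open Scope ring_scope.

Local Notation groot := Defs.root.

(** * Gluing graphs, and the partition functions of rooted trees *)

Section Glue.
Variables (G H : graph) (e : G -> H -> bool).

Definition glue_adj (a b : G + H) : bool :=
  match a, b with
  | inl x, inl y => adj x y
  | inr x, inr y => adj x y
  | inl x, inr y | inr y, inl x => e x y
  end.

Lemma glue_adj_sym : symmetric glue_adj.
Proof. by case=> x [] y //=; rewrite adj_sym. Qed.

Lemma glue_adj_irr : irreflexive glue_adj.
Proof. by case=> x /=; rewrite adj_irr. Qed.

Definition glue : graph := Graph glue_adj_sym glue_adj_irr.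

(** Vertex sets of a glued graph are pairs of vertex sets, so that sums over
    independent sets factor. *)
Definition set_sum (AB : {set G} * {set H}) : {set glue} :=
  [set z : glue | match z with inl x => x \in AB.1 | inr y => y \in AB.2 end].

Lemma set_sum_bij : bijective set_sum.
Proof.
exists (fun I : {set glue} =>
    ([set x : G | (inl x : glue) \in I], [set y : H | (inr y : glue) \in I])).
  by case=> A B; congr (_, _); apply/setP => x; rewrite !inE.
by move=> I; apply/setP => -[x|y]; rewrite !inE.
Qed.

Lemma card_set_sum A B : #|set_sum (A, B)| = (#|A| + #|B|)%N.
Proof.
have -> : set_sum (A, B) = [set (inl x : glue) | x in A] :|: [set (inr y : glue) | y in B].
  apply/setP => -[x|y]; rewrite !inE.
    rewrite (mem_imset (f := fun x => inl x : glue)) => [|u v []//].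
    case: imsetP => [[y _ //]|_]; by rewrite orbF.
  rewrite (mem_imset (f := fun x => inr x : glue)) => [|u v []//].
  by case: imsetP => [[x _ //]|_].
rewrite cardsU !card_imset => [|u v []//|u v []//].
rewrite (_ : _ :&: _ = finset.set0) ?cards0 ?subn0//.
apply/setP => z; rewrite !inE; apply/negP => /andP[/imsetP[x _ ->] /imsetP[y _]] //.
Qed.

Lemma indep_set_sum A B : independent (set_sum (A, B)) =
  [&& independent A, independent B & [forall x in A, forall y in B, ~~ e x y]].
Proof.
apply/idP/idP => [/forall_inP indep|/and3P[/forall_inP iA /forall_inP iB /forall_inP eAB]].
  apply/and3P; split; apply/forall_inP => x xA; apply/forall_inP => y yA.
  - have /forall_inP/(_ (inl y)) := indep (inl x) ltac:(by rewrite inE).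
    by apply; rewrite inE.
  - have /forall_inP/(_ (inr y)) := indep (inr x) ltac:(by rewrite inE).
    by apply; rewrite inE.
  - have /forall_inP/(_ (inr y)) := indep (inl x) ltac:(by rewrite inE).
    by apply; rewrite inE.
apply/forall_inP => -[x|x]; rewrite inE /= => xA; apply/forall_inP => -[y|y]; rewrite inE /= => yA.
- exact: (forall_inP (iA x xA)).
- exact: (forall_inP (eAB x xA)).
- exact: (forall_inP (eAB y yA)).
- exact: (forall_inP (iB x xA)).
Qed.

End Glue.



Definition zin (K : comNzRingType) (G : rooted_graph) (l : K) : K :=
  \sum_(I : {set G} | independent I && (groot G \in I)) l ^+ #|I|.
Definition zout (K : comNzRingType) (G : rooted_graph) (l : K) : K :=
  \sum_(I : {set G} | independent I && (groot G \notin I)) l ^+ #|I|.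

Lemma indep_poly_root (K : comNzRingType) (G : rooted_graph) (l : K) :
  indep_poly G l = zout G l + zin G l.
Proof. by rewrite /indep_poly (bigID (fun I : {set G} => groot G \in I)) /= addrC. Qed.

Lemma indep_poly_disjoint (K : comNzRingType) (G H : graph) (l : K) :
  indep_poly (glue (fun (_ : G) (_ : H) => false)) l = indep_poly G l * indep_poly H l.
Proof.
set e := fun (_ : G) (_ : H) => false.
rewrite big_distrl /=; under [RHS]eq_bigr do rewrite big_distrr /=.
rewrite pair_big /= /indep_poly (reindex (set_sum e)); last exact: onW_bij (set_sum_bij e).
apply: eq_big => [[A B]|[A B] _] /=; last by rewrite card_set_sum exprD.
rewrite indep_set_sum; congr (_ && _).
by rewrite [X in _ && X](_ : _ = true) ?andbT//; apply/forall_inP => x _; apply/forall_inP.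
Qed.

(** Adds H as one more child of the root of G.  Building trees by this binary
    operation makes each step a product of two factors. *)
Definition attach (G H : rooted_graph) : rooted_graph :=
  @RootedGraph (glue (fun (x : G) (y : H) => (x == groot G) && (y == groot H)))
    (inl (groot G)).

Lemma indep_attach (G H : rooted_graph) (A : {set G}) (B : {set H}) :
  independent (set_sum (fun x y => (x == groot G) && (y == groot H)) (A, B)) =
  [&& independent A, independent B & ~~ ((groot G \in A) && (groot H \in B))].
Proof.
rewrite indep_set_sum; congr [&& _, _ & _]; apply/idP/idP.
  move=> /forall_inP h; apply/negP => /andP[rA rB].
  by have /forall_inP/(_ _ rB) := h _ rA; rewrite !eqxx.
move=> h; apply/forall_inP => x xA; apply/forall_inP => y yB.
by apply: contra h => /andP[/eqP <- /eqP <-]; rewrite xA.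
Qed.

Lemma zin_attach (K : comNzRingType) (G H : rooted_graph) (l : K) :
  zin (attach G H) l = zin G l * zout H l.
Proof.
set e := fun (x : G) (y : H) => (x == groot G) && (y == groot H).
rewrite /zin /zout big_distrl /=; under [RHS]eq_bigr do rewrite big_distrr /=.
rewrite pair_big /= (reindex (set_sum e)); last exact: onW_bij (set_sum_bij e).
apply: eq_big => [[A B]|[A B] _] /=; last by rewrite card_set_sum exprD.
by rewrite indep_attach inE /=; case: (groot G \in A); case: (groot H \in B);
  rewrite /= ?andbT ?andbF.
Qed.

Lemma zout_attach (K : comNzRingType) (G H : rooted_graph) (l : K) :
  zout (attach G H) l = zout G l * (zout H l + zin H l).
Proof.
set e := fun (x : G) (y : H) => (x == groot G) && (y == groot H).
rewrite -indep_poly_root /indep_poly /zout big_distrl /=.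
under [RHS]eq_bigr do rewrite big_distrr /=.
rewrite pair_big /= (reindex (set_sum e)); last exact: onW_bij (set_sum_bij e).
apply: eq_big => [[A B]|[A B] _] /=; last by rewrite card_set_sum exprD.
rewrite indep_attach inE /=; case: (groot G \in A); case: (groot H \in B);
  by rewrite /= ?andbT ?andbF.
Qed.

Lemma zin_single (K : comNzRingType) (l : K) : zin single_vertex l = l.
Proof.
rewrite /zin (big_pred1 [set: unit]) ?cardsT ?card_unit ?expr1// => I /=.
apply/idP/eqP => [/andP[_ rI]|->].
  by apply/setP => -[]; rewrite inE rI.
by rewrite inE andbT; apply/forall_inP => x _; apply/forall_inP.
Qed.

Lemma zout_single (K : comNzRingType) (l : K) : zout single_vertex l = 1.
Proof.
rewrite /zout (big_pred1 (finset.set0 : {set unit})) ?cards0 ?expr0// => I /=.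
apply/idP/eqP => [/andP[_ rI]|->].
  by apply/setP => -[]; rewrite inE (negbTE rI).
by rewrite inE andbT; apply/forall_inP => x; rewrite inE.
Qed.

Definition degree (G : graph) (x : G) : nat := #|[set y | adj x y]|.

Lemma degree_inl (G H : graph) (e : G -> H -> bool) (x : G) :
  degree (inl x : glue e) = (degree x + #|[set y | e x y]|)%N.
Proof.
rewrite /degree -(card_set_sum e); congr (#|pred_of_set _|).
by apply/setP => -[y|y]; rewrite !inE.
Qed.

Lemma degree_inr (G H : graph) (e : G -> H -> bool) (y : H) :
  degree (inr y : glue e) = (#|[set x | e x y]| + degree y)%N.
Proof.
rewrite /degree -(card_set_sum e); congr (#|pred_of_set _|).
by apply/setP => -[x|x]; rewrite !inE.
Qed.

(** Of the D neighbours allowed, a branch leaves the room needed to join its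
    root to a parent as soon as k < D. *)
Definition branch (D k : nat) (G : rooted_graph) : Prop :=
  (degree (groot G) <= k)%N /\ max_degree_le D G.

Lemma branch_single D : branch D 0 single_vertex.
Proof.
have deg0 (x : single_vertex) : degree x = 0%N.
  by rewrite /degree (_ : [set y | _] = finset.set0) ?cards0//; apply/setP => y; rewrite !inE.
by split=> [|x]; [rewrite deg0 | have := deg0 x; rewrite /degree => ->].
Qed.

Lemma branch_attach D k d (G H : rooted_graph) : (k < D)%N -> (d < D)%N ->
  branch D k G -> branch D d H -> branch D k.+1 (attach G H).
Proof.
move=> kD dD [rG mG] [rH mH].
have card_and (T : finType) (t : T) (b : bool) :
    #|[set y | b && (y == t)]| = b.
  case: b => /=; last by apply/eqP; rewrite cards_eq0; apply/eqP/setP => y; rewrite !inE.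
  by rewrite -[RHS](cards1 t); congr (#|pred_of_set _|); apply/setP => y; rewrite !inE.
have degG (x : G) : degree (inl x : attach G H) = (degree x + (x == groot G))%N.
  by rewrite degree_inl card_and.
have degH (y : H) : degree (inr y : attach G H) = ((y == groot H) + degree y)%N.
  rewrite degree_inr; under eq_finset do rewrite andbC; by rewrite card_and.
split=> [|[x|y]]; first by rewrite degG eqxx addn1 ltnS.
- rewrite -/(degree (inl x : attach G H)) degG; have [->|_] := eqVneq x (groot G).
    by rewrite addn1; exact: leq_trans kD.
  by rewrite addn0 mG.
- rewrite -/(degree (inr y : attach G H)) degH; have [->|_] := eqVneq y (groot H).
    by rewrite add1n; exact: leq_trans dD.
  by rewrite add0n mH.
Qed.

(** A pair stands for the partition functions of the independent sets avoiding,
    respectively containing, the root; this is the recursion of a tree whose root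
    has the branches s as children. *)
Definition node_pair (K : comNzRingType) (l : K) (s : seq (K * K)) : K * K :=
  (\prod_(t <- s) (t.1 + t.2), l * \prod_(t <- s) t.1).

Definition zpair (K : comNzRingType) (l : K) (G : rooted_graph) : K * K :=
  (zout G l, zin G l).

Definition graph_node (s : seq rooted_graph) : rooted_graph :=
  foldr (fun H G => attach G H) single_vertex s.

Lemma zpair_graph_node (K : comNzRingType) (l : K) s :
  zpair l (graph_node s) = node_pair l (map (zpair l) s).
Proof.
elim: s => [|H s IH] /=; first by rewrite /zpair /node_pair !big_nil zin_single zout_single mulr1.
have /= [Eo Ei] := IH; rewrite /zpair /node_pair zin_attach zout_attach Eo Ei !big_cons /=.
congr (_, _); first exact: mulrC.
by rewrite mulrAC -mulrA.
Qed.

Lemma branch_graph_node d (s : seq rooted_graph) : (size s <= d)%N ->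
  List.Forall (branch d.+1 d) s -> branch d.+1 d (graph_node s).
Proof.
move=> sd gs.
suff [rs ms] : branch d.+1 (size s) (graph_node s) by split=> //; exact: leq_trans sd.
elim: gs sd => [_|H s' gH _ IH sd] /=; first exact: branch_single.
by apply: branch_attach gH => //; [exact: leqW | exact: IH (ltnW sd)].
Qed.

Inductive tree_pair (K : comNzRingType) (l : K) (d : nat) : K * K -> Prop :=
  TreePair s of (size s <= d)%N & (forall t, t \in s -> tree_pair l d t) :
    tree_pair l d (node_pair l s).

(** With l the indeterminate, each pair of polynomials built by the recursion is
    realised by an actual graph of maximum degree d.+1. *)
Lemma tree_pair_graph (K : comNzRingType) (l : K) d t : tree_pair l d t ->
  exists2 G, branch d.+1 d G & zpair l G = t.
Proof.
elim=> s sd _ IH.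
suff [gs [bs es]] : exists gs : seq rooted_graph,
    List.Forall (branch d.+1 d) gs /\ map (zpair l) gs = s.
  exists (graph_node gs); last by rewrite zpair_graph_node es.
  by apply: branch_graph_node bs; rewrite -(size_map (zpair l)) es.
elim: s IH {sd} => [_|v s IHs IH]; first by exists [::]; split.
have [|gs [bs <-]] := IHs; first by move=> u us; apply: IH; rewrite inE us orbT.
have [G bG <-] := IH v (mem_head _ _).
by exists (G :: gs); split=> //; constructor.
Qed.

(** * Padding with isolated vertices *)

Lemma walkP (G : graph) k (x y : G) :
  reflect (exists p : seq G, [/\ size p = k, path (@adj G) x p & last x p = y])
    (walk_of_length k x y).
Proof.
apply: (iffP existsP) => [[p /andP[xp /eqP lp]]|[p [<- xp lp]]].
  by exists p; split=> //; exact: size_tuple.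
by exists (in_tuple p); rewrite /= xp lp eqxx.
Qed.

Lemma walk_join d (T : 'I_d -> rooted_graph) (i : 'I_d) k (x : T i) :
  walk_of_length k (groot (T i)) x ->
  walk_of_length k.+1 (groot (join T)) (Some (Tagged (fun j => vertex (T j)) x)).
Proof.
move=> /walkP[p [sp xp lp]]; apply/walkP.
pose in_i (y : T i) : join T := Some (Tagged (fun j => vertex (T j)) y).
exists (in_i (groot (T i)) :: map in_i p); split; rewrite /= ?size_map ?sp//.
  rewrite eqxx /= path_map; apply: sub_path xp => a b ab /=.
  by rewrite eqxx tagged_asE.
by rewrite last_map lp.
Qed.

Definition non_isolated (G : graph) : {set G} := [set x | [exists y, adj x y]].

(** Along the recursion the current vertex is removed, and it is not isolated as
    soon as it has a child; so the depth is at most the number of non isolated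
    vertices. *)
Lemma SAW_rec_walk (G : graph) (le : rel G) n (U : {set G}) (v : G)
    (x : SAW_rec le n U v) : v \in U ->
  exists2 k, (k <= #|U :&: non_isolated G|)%N & walk_of_length k (groot _) x.
Proof.
have walk0 (H : graph) (y : H) : walk_of_length 0 y y by apply/walkP; exists [::].
elim: n => [|n IH] /= in U v x *.
  by exists 0%N => //; case: x; exact: walk0.
move=> vU; case: x => [[i x]|]; last by exists 0%N => //; exact: walk0.
set nbrs := sort _ _ in i x *.
have inbr : nth v nbrs i \in nbrs by rewrite mem_nth.
have := inbr; rewrite {1}/nbrs mem_sort mem_enum inE => /andP[wU vw].
set w := nth v nbrs i in x inbr wU vw *; set U' := U :\: _ in x *.
have wU' : w \in U'.
  rewrite !inE wU andbT negb_or; apply/andP; split.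
    by apply: contraTneq vw => ->; rewrite adj_irr.
  have unbrs : uniq nbrs by rewrite sort_uniq enum_uniq.
  rewrite /w; apply/negP => win; have := unbrs.
  rewrite -{1}(cat_take_drop i nbrs) cat_uniq => /and3P[_ /hasPn/(_ w) h _].
  have : w \in drop i nbrs by rewrite (drop_nth v)// mem_head.
  by move=> /h; rewrite /= win.
have [k kle kw] := IH _ _ x wU'.
exists k.+1; last exact: walk_join kw.
apply: leq_ltn_trans kle _; apply: proper_card; apply/properP; split.
  by apply: finset.setSI; exact: finset.subsetDl.
exists v; rewrite !inE ?vU ?eqxx//=.
by apply/existsP; exists w.
Qed.

Lemma sphere_SAW (G : graph) (le : rel G) (U : {set G}) (v : G) l :
  v \in U -> (#|non_isolated G| < l)%N ->
  sphere (groot (SAW_tree le U v)) l = finset.set0.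
Proof.
move=> vU Xl; apply/setP => x; rewrite !inE; apply/negP => /andP[_ /forallP h].
have [k kle kw] := @SAW_rec_walk _ _ _ _ _ x vU.
have kl : (k < l)%N.
  by apply: leq_ltn_trans kle (leq_ltn_trans (subset_leq_card (finset.subsetIr _ _)) Xl).
by have := h (Ordinal kl); rewrite kw.
Qed.

(** If phi #|G| exceeds the depth of all the trees involved, the spheres are
    empty, only the empty boundary condition is left, and the two ratios
    coincide. *)
Lemma VSSM_far (R : realType) (ord : forall G : graph, rel G)
    (F : graph -> Prop) (phi : nat -> R) (lambda : R) :
  (forall G, F G -> (#|non_isolated G|)%:R < phi #|G|) ->
  VSSM ord F phi lambda.
Proof.
move=> Fphi; exists 0, 1; split=> // G FG U v vU l l_gt0 phil T sigma tau _ ds _ dt.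
have s0 : sphere (groot T) l = finset.set0.
  by apply: sphere_SAW => //; rewrite -(ltr_nat R); exact: lt_le_trans (Fphi _ FG) phil.
suff -> : sigma = tau by rewrite subrr normr0 mul1r exprn_ge0.
apply/ffunP => x.
have := congr1 (fun A : {set T} => x \in A) s0; rewrite -{1}ds !inE => /negbFE/eqP ->.
by have := congr1 (fun A : {set T} => x \in A) s0; rewrite -{1}dt !inE => /negbFE/eqP ->.
Qed.

Lemma edgeless_irr (T : finType) : irreflexive (fun _ _ : T => false).
Proof. by []. Qed.
Lemma edgeless_sym (T : finType) : symmetric (fun _ _ : T => false).
Proof. by []. Qed.
Definition edgeless (T : finType) : graph := Graph (@edgeless_sym T) (@edgeless_irr T).

Definition pad (G : graph) (N : nat) : graph :=
  glue (fun (_ : G) (_ : edgeless 'I_N) => false).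

Lemma card_pad G N : #|pad G N| = (#|G| + N)%N.
Proof. by rewrite card_sum card_ord. Qed.

Lemma non_isolated_pad G N : (#|non_isolated (pad G N)| <= #|G|)%N.
Proof.
rewrite -cardsT -(card_imset _ (@inl_inj G 'I_N)); apply: subset_leq_card.
apply/fintype.subsetP => -[x _|y]; first exact: imset_f.
by rewrite inE => /existsP[[]].
Qed.

Lemma max_degree_pad D G N : max_degree_le D G -> max_degree_le D (pad G N).
Proof.
have none (T : finType) : #|[set _ : T | false]| = 0%N.
  by apply/eqP; rewrite cards_eq0; apply/eqP/setP => y; rewrite !inE.
move=> mG [x|y]; first by have := mG x; have := degree_inl (fun (_ : G) (_ : edgeless 'I_N) => false) x;
  rewrite none addn0 /degree => ->.
by have := degree_inr (fun (_ : G) (_ : edgeless 'I_N) => false) y;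
  rewrite none /degree none => ->.
Qed.

Lemma indep_poly_pad_eq0 (K : comNzRingType) G N (l : K) :
  indep_poly G l = 0 -> indep_poly (pad G N) l = 0.
Proof. by move=> G0; rewrite indep_poly_disjoint G0 mul0r. Qed.

(** The family consists of all graphs of the right degree with few non isolated
    vertices.  It contains every graph after padding, whatever zero that graph
    has. *)
Lemma padded_family_of_zeros (R : realType)
    (ord : forall G : graph, rel G) (phi : nat -> R)
    (phi_incr : forall m n : nat, (0 < m)%N -> (m <= n)%N -> phi m <= phi n)
    (phi_unbounded : forall M : R, exists n : nat, (0 < n)%N /\ M < phi n)
    (Delta : nat) (c lambda_star : R) :
  (forall eps : R, 0 < eps -> exists G (z : R[i]), [/\ max_degree_le Delta G,
     indep_poly G z = 0 & `|c%:C%C - z| < eps%:C%C]) ->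
  exists F : graph -> Prop,
    [/\ forall G : graph, F G -> max_degree_le Delta G,
        forall lambda : R, 0 <= lambda -> lambda <= lambda_star ->
          VSSM ord F phi lambda
      & exists (G : nat -> graph) (lambda : nat -> R[i]),
          [/\ forall n : nat, F (G n),
              forall n : nat, indep_poly (G n) (lambda n) = 0
            & (lambda n @[n --> \oo] --> (c%:C%C : (R[i])^o))%classic]].
Proof.
move=> zeros.
exists (fun G => max_degree_le Delta G /\ (#|non_isolated G|)%:R < phi #|G|).
split=> [G []//|lambda _ _|]; first by apply: VSSM_far => G [].
have pos n : 0 < n.+1%:R^-1 :> R by rewrite invr_gt0 ltr0n.
have [G0 G0P] := choice (fun n => zeros _ (pos n)).
have [z zP] := choice G0P.
have [N NP] := choice (fun n => phi_unbounded (#|G0 n|)%:R).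
exists (fun n => pad (G0 n) (N n)), z; split=> [n|n|].
- have [mG _ _] := zP n; have [N0 Nphi] := NP n; split; first exact: max_degree_pad.
  rewrite card_pad; apply: le_lt_trans (lt_le_trans Nphi (phi_incr _ _ N0 (leq_addl _ _))).
  by rewrite ler_nat non_isolated_pad.
- by have [_ Z0 _] := zP n; exact: indep_poly_pad_eq0.
apply/(@cvgrPdist_lt _ (R[i])^o) => e e0.
have [e' e'0 ->] : exists2 e' : R, 0 < e' & e = e'%:C%C.
  exists (complex.Re e); last by apply/esym; rewrite RRe_real// gtr0_real.
  by move: e0; rewrite ltcE => /andP[].
near=> n; have [_ _ /lt_trans] := zP n; apply; rewrite ltcR.
near: n; exact: near_infty_natSinv_lt (PosNum e'0).
Unshelve. all: by end_near.
Qed.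

(** * Taylor approximation of the logarithm of a zero-free polynomial *)

Lemma normcX (R : realType) (w : R[i]) n : normc (w ^+ n) = normc w ^+ n.
Proof. by elim: n => [|n IH]; rewrite ?expr0 ?normc1// !exprS normcM IH. Qed.

Lemma normcR (R : realType) (x : R) : normc x%:C%C = `|x|.
Proof. by rewrite /= expr0n addr0 sqrtr_sqr. Qed.

Lemma normc_ge0 (R : realType) (w : R[i]) : 0 <= normc w.
Proof. by case: w => a b; exact: sqrtr_ge0. Qed.

Lemma ler_Re_normc (R : realType) (w : R[i]) : `|complex.Re w| <= normc w.
Proof. by case: w => a b /=; rewrite -sqrtr_sqr ler_wsqrtr// lerDl sqr_ge0. Qed.

Lemma ReD (R : realType) (a b : R[i]) : complex.Re (a + b) = complex.Re a + complex.Re b.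
Proof. by case: a b => [? ?] [? ?]. Qed.

Lemma ReB (R : realType) (a b : R[i]) : complex.Re (a - b) = complex.Re a - complex.Re b.
Proof. by case: a b => [? ?] [? ?]. Qed.

Lemma Re_sum (R : realType) n (f : nat -> R[i]) :
  complex.Re (\sum_(i < n) f i) = \sum_(i < n) complex.Re (f i).
Proof. by elim: n => [|n IH]; rewrite ?big_ord0// !big_ord_recr/= ReD IH. Qed.

Lemma ReM_real (R : realType) (x : R) (a : R[i]) :
  complex.Re (x%:C%C * a) = x * complex.Re a.
Proof. by case: a => a b /=; rewrite mul0r subr0. Qed.

Lemma sqr_normc_ReIm (R : realType) (w : R[i]) :
  normc w ^+ 2 = complex.Re w ^+ 2 + complex.Im w ^+ 2.
Proof. by case: w => a b /=; rewrite sqr_sqrtr// addr_ge0 ?sqr_ge0. Qed.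

Lemma Re_div (R : realType) (w D : R[i]) : complex.Re (w / D) =
  (complex.Re w * complex.Re D + complex.Im w * complex.Im D) / normc D ^+ 2.
Proof. by rewrite sqr_normc_ReIm; case: w D => [a b] [c d] /=; ring. Qed.

Lemma half_le_normc (R : realType) (w : R[i]) (r x : R) :
  0 < r -> normc w <= r^-1 -> 0 <= x -> x <= r / 2 ->
  1/2 <= normc (1 - x%:C%C * w).
Proof.
move=> r0 wr x0 xr.
have xw : normc (x%:C%C * w) <= 1/2.
  rewrite normcM normcR ger0_norm//.
  apply: le_trans (_ : (r / 2) * r^-1 <= _); first by apply: ler_pM => //; exact: normc_ge0.
  by rewrite mulrAC mulfV ?gt_eqF.
have := le_normcD (1 - x%:C%C * w) (x%:C%C * w); rewrite subrK normc1; lra.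
Qed.

(** The derivative of ln |1 - z w|^2 is - 2 Re (w / (1 - z w)), which differs from
    its Taylor polynomial by the remainder of a geometric series; the mean value
    theorem integrates this bound. *)
Lemma log_factor (R : realType) (w : R[i]) (r : R) (j : nat) :
  0 < r -> normc w <= r^-1 ->
  exists2 q : {poly R}, (size q <= j.+1)%N & forall z : R, 0 <= z -> z <= r / 2 ->
    `|ln (normc (1 - z%:C%C * w) ^+ 2) - q.[z]| <= 4 * (z / r) ^+ j.+1.
Proof.
move=> r0 wr.
pose q : {poly R} := \sum_(i < j) (- 2 * complex.Re (w ^+ i.+1) / i.+1%:R) *: 'X^(i.+1).
exists q.
  apply: (leq_trans (size_sum _ _ _)); apply/bigmax_leqP => i _.
  by apply: (leq_trans (size_scale_leq _ _)); rewrite size_polyXn !ltnS.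
move=> z z0 zr.
pose P : {poly R} := 1 - (2 * complex.Re w) *: 'X + (normc w ^+ 2) *: 'X^2.
have PE x : P.[x] = normc (1 - x%:C%C * w) ^+ 2.
  rewrite /P !hornerE; case: w {wr q P} => a b /=.
  rewrite !sqr_sqrtr ?addr_ge0 ?sqr_ge0//; ring.
have D2 (x : R) := half_le_normc r0 wr (x := x).
have P0 (x : R) : 0 <= x -> x <= r / 2 -> 0 < P.[x].
  by move=> x0 xr; rewrite PE exprn_gt0//; have := D2 x x0 xr; lra.
have dF (x : R) : x \in `[0, z] ->
    is_derive x 1 (fun y => ln P.[y] - q.[y]) (P^`().[x] / P.[x] - q^`().[x]).
  rewrite in_itv /= => /andP[x0 xz].
  have Px := P0 x x0 (le_trans xz zr).
  have dln : is_derive x 1 (fun y => ln P.[y]) (P^`().[x] / P.[x]).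
    by rewrite mulrC; exact: (is_derive1_comp (is_derive1_ln Px) (is_derive_poly P x)).
  exact: (is_deriveB dln (is_derive_poly q x)).
have rem (x : R) : 0 <= x -> x <= z -> `|P^`().[x] / P.[x] - q^`().[x]| <= 4 * r^-1 ^+ j.+1 * z ^+ j.
  move=> x0 xz; have xr := le_trans xz zr.
  set D := 1 - x%:C%C * w.
  have nD := D2 x x0 xr.
  have D0 : D != 0.
    by apply: contraTneq nD; rewrite -/D => ->; rewrite normc0 -ltNge; lra.
  have -> : P^`().[x] / P.[x] = - 2 * complex.Re (w / D).
    have -> : P^`().[x] = - 2 * complex.Re w + 2 * normc w ^+ 2 * x.
      by rewrite /P; move: (normc w ^+ 2) => n2; rewrite !poly.derivE !hornerE; ring.
    rewrite Re_div PE -/D [RHS]mulrA; congr (_ / _).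
    rewrite sqr_normc_ReIm /D; case: (w) => a b /=; ring.
  have -> : q^`().[x] = - 2 * complex.Re (w * (1 - (x%:C%C * w) ^+ j) / D).
    (* Geometric series for w / (1 - x w), truncated after j terms. *)
    have -> : w * (1 - (x%:C%C * w) ^+ j) / D = \sum_(i < j) (x ^+ i)%:C%C * w ^+ i.+1.
      apply: (mulIf D0); rewrite divfK// -[X in X - _](expr1n _ j) subrXX.
      rewrite -/D [D * _]mulrC mulrA; congr (_ * D).
      rewrite mulr_sumr; apply: eq_bigr => i _.
      by rewrite expr1n mul1r exprMn mulrCA -exprS rmorphXn.
    rewrite (Re_sum _ (fun i => (x ^+ i)%:C%C * w ^+ i.+1)) mulr_sumr raddf_sum horner_sum.
    apply: eq_bigr => i _; rewrite ReM_real [X in X.[x]]poly.derivZ derivXn !hornerE hornerMn hornerXn /=.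
    by rewrite -mulr_natr; field; rewrite nat1r pnatr_eq0.
  rewrite -mulrBr -ReB.
  have -> : w / D - w * (1 - (x%:C%C * w) ^+ j) / D = w * (x%:C%C * w) ^+ j / D.
    by rewrite -mulrBl mulrBr mulr1 subKr.
  rewrite normrM normrN normr_nat.
  have := ler_Re_normc (w * (x%:C%C * w) ^+ j / D).
  rewrite !normcM normcV normcX normcM normcR (ger0_norm x0) [(x * _) ^+ j]exprMn => h.
  have w0 := normc_ge0 w.
  have wj : normc w * (x ^+ j * normc w ^+ j) <= r^-1 ^+ j.+1 * z ^+ j.
    rewrite mulrCA -exprS mulrC; apply: ler_pM; rewrite ?exprn_ge0//.
      by rewrite lerXn2r ?nnegrE ?invr_ge0 ?(ltW r0).
    by rewrite lerXn2r ?nnegrE.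
  have iD : (normc D)^-1 <= 2 by rewrite -[2]invrK lef_pV2 ?posrE; lra.
  have : normc w * (x ^+ j * normc w ^+ j) / normc D <= r^-1 ^+ j.+1 * z ^+ j * 2.
    by apply: ler_pM => //; rewrite ?invr_ge0 ?normc_ge0// !mulr_ge0 ?exprn_ge0.
  by move: h; lra.
have F0 : ln P.[0] - q.[0] = 0.
  rewrite PE mul0r subr0 normc1 expr1n ln1 sub0r /q horner_sum big1 ?oppr0// => i _.
  by rewrite !hornerE expr0n mulr0.
rewrite -PE.
have cont : ({within `[0, z], continuous (fun y => ln P.[y] - q.[y])})%classic.
  by apply: derivable_within_continuous => x /dF [].
have [c] := MVT_segment z0 (fun x xz => dF x (subset_itv_oo_cc xz)) cont.
rewrite F0 !subr0 in_itv /= => /andP[c0 cz] ->.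
rewrite normrM (ger0_norm z0).
apply: le_trans (_ : 4 * r^-1 ^+ j.+1 * z ^+ j * z <= _).
  by rewrite ler_wpM2r// rem.
by rewrite [(z / r) ^+ _]exprMn [z ^+ j.+1]exprSr; lra.
Qed.

(** The logarithm of p^2 is, up to a constant, the sum of the contributions
    ln |1 - z / (w - l)|^2 of the roots w, to which [log_factor] applies.  The
    error is only linear in the degree, whereas p itself may vary by a factor
    exponential in it. *)
Lemma log_poly (R : realType) (p : {poly R}) (l r : R) (N j : nat) :
  0 < r -> (size p <= N.+1)%N -> p.[l] != 0 ->
  (forall w : R[i], (map_poly (real_complex R) p).[w] = 0 -> r <= normc (w - l%:C%C)) ->
  exists2 q : {poly R}, (size q <= j.+1)%N & forall z : R, 0 <= z -> z <= r / 2 ->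
    `|ln (p.[l + z] ^+ 2) - q.[z]| <= 4 * N%:R * (z / r) ^+ j.+1.
Proof.
move=> r0 sp pl0 far.
have [s ps] := closed_field_poly_normal (map_poly (real_complex R) p).
set c := lead_coef _ in ps.
have c0 : c != 0.
  by rewrite lead_coef_eq0 map_poly_eq0; apply: contraNneq pl0 => ->; rewrite horner0.
have sN : (size s <= N)%N.
  by rewrite -ltnS; apply: leq_trans sp; rewrite -(size_map_poly (real_complex R) p) ps
    size_scale// size_prod_XsubC.
have sfar w : w \in s -> r <= normc (w - l%:C%C).
  move=> ws; apply: far; rewrite ps hornerZ; apply/eqP; rewrite mulf_eq0 [X in _ || X](_ : _ = true) ?orbT//.
  by rewrite -/(root _ _) root_prod_XsubC.
have [q sq qP] : exists2 q : {poly R}, (size q <= j.+1)%N &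
    forall z : R, 0 <= z -> z <= r / 2 ->
      0 < normc (\prod_(w <- s) ((l + z)%:C%C - w)) /\
      `|ln (normc (\prod_(w <- s) ((l + z)%:C%C - w)) ^+ 2) - q.[z]|
        <= 4 * (size s)%:R * (z / r) ^+ j.+1.
  elim: s sfar {ps sN} => [_|w s IH sfar].
    exists 0; rewrite ?size_poly0// => z z0 zr.
    by rewrite big_nil normc1 expr1n ln1 horner0 subr0 normr0 mulr0 mul0r; split.
  have [|q sq qP] := IH; first by move=> v vs; apply: sfar; rewrite inE vs orbT.
  have rw : r <= normc (w - l%:C%C) by apply: sfar; rewrite mem_head.
  have wl0 : w - l%:C%C != 0.
    by apply: contraTneq rw => ->; rewrite normc0 -ltNge.
  have iw : normc (w - l%:C%C)^-1 <= r^-1.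
    by rewrite normcV lef_pV2 ?posrE// (lt_le_trans r0).
  have [q' sq' q'P] := log_factor j r0 iw.
  pose k := ln (normc (w - l%:C%C) ^+ 2).
  exists (k%:P + q' + q).
    rewrite !(leq_trans (size_polyD _ _))// geq_max sq andbT.
    by rewrite (leq_trans (size_polyD _ _))// geq_max sq' andbT (leq_trans (size_polyC_leq1 _)).
  move=> z z0 zr; have [pos le1] := qP z z0 zr; have le2 := q'P z z0 zr.
  rewrite big_cons normcM.
  have -> : (l + z)%:C%C - w = - ((w - l%:C%C) * (1 - z%:C%C * (w - l%:C%C)^-1)).
    by rewrite rmorphD /=; field.
  set f := 1 - _ in le2 *.
  have f0 : 0 < normc f by have := half_le_normc r0 iw z0 zr; rewrite -/f; lra.
  rewrite normcN normcM; have npos : 0 < normc (w - l%:C%C) by exact: lt_le_trans rw.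
  split; first by rewrite !mulr_gt0.
  rewrite [X in ln X]exprMn [X in ln (X * _)]exprMn.
  rewrite lnM ?posrE ?mulr_gt0 ?exprn_gt0// lnM ?posrE ?exprn_gt0// -/k !hornerD hornerC /= -[(size s).+1]addn1 natrD.
  set A := ln _ in le2 *; set B := ln _ in le1 *.
  have -> : k + A + B - (k + q'.[z] + q.[z]) = (A - q'.[z]) + (B - q.[z]) by ring.
  by apply: le_trans (ler_normD _ _) _; lra.
pose k := ln (normc c ^+ 2).
exists (k%:P + q).
  by rewrite (leq_trans (size_polyD _ _))// geq_max sq andbT (leq_trans (size_polyC_leq1 _)).
move=> z z0 zr; have [pos le1] := qP z z0 zr.
have -> : p.[l + z] ^+ 2 = normc (map_poly (real_complex R) p).[(l + z)%:C%C] ^+ 2.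
  by rewrite horner_map normcR real_normK ?num_real.
have nc : 0 < normc c.
  by rewrite lt_def normc_ge0 andbT; apply: contra c0 => /eqP/eq0_normc ->.
rewrite ps hornerZ horner_prod (eq_bigr (fun w => (l + z)%:C%C - w)); last first.
  by move=> w _; rewrite hornerXsubC.
rewrite normcM exprMn lnM ?posrE ?exprn_gt0// hornerD hornerC -/k.
rewrite opprD addrACA subrr add0r.
apply: le_trans le1 _; rewrite ler_wpM2r ?exprn_ge0 ?divr_ge0 ?(ltW r0)//.
by rewrite ler_wpM2l// ler_nat.
Qed.

(** * Polynomials of bounded degree on a short interval *)

(** Equivalence of norms in finite dimension, by induction on the degree. *)
Lemma coef_bound (R : realType) (j : nat) : exists2 C : R, 0 <= C &
  forall (q : {poly R}) (M : R), (size q <= j)%N ->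
    (forall s : R, 0 <= s -> s <= 1 -> `|q.[s]| <= M) -> forall i, `|q`_i| <= C * M.
Proof.
elim: j => [|j [C C0 IH]].
  exists 0 => // q M; rewrite size_poly_leq0 => /eqP -> _ i.
  by rewrite coef0 normr0 mul0r.
exists (1 + j.+1%:R * (C * (1 + 2 ^+ j))).
  by rewrite addr_ge0// !mulr_ge0// addr_ge0// exprn_ge0.
move=> q M sq qM.
have M0 : 0 <= M by apply: le_trans (qM 0 _ _).
(* The combination q(s) - 2^j q(s / 2) cancels the coefficient of degree j and
   multiplies the one of degree i < j by 1 - 2^(j - i), which is at most -1. *)
pose p := \poly_(i < j) (q`_i * (1 - 2 ^+ (j - i))).
have pE s : p.[s] = q.[s] - 2 ^+ j * q.[s / 2].
  rewrite (horner_coef_wide _ sq) (horner_coef_wide (s / 2) sq) horner_poly.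
  rewrite !big_ord_recr /= mulrDr mulr_sumr opprD addrACA.
  rewrite -sumrB [X in _ + X](_ : _ = 0) ?addr0.
    apply: eq_bigr => i _; rewrite exprMn exprVn -[X in _ - 2 ^+ X * _](subnK (ltnW (ltn_ord i))).
    by rewrite exprD; field; rewrite expf_neq0.
  by rewrite exprMn exprVn; field; rewrite expf_neq0.
have pM s : 0 <= s -> s <= 1 -> `|p.[s]| <= (1 + 2 ^+ j) * M.
  move=> s0 s1; rewrite pE (le_trans (ler_normB _ _))// mulrDl mul1r lerD ?qM//.
  rewrite normrM ger0_norm ?exprn_ge0// ler_wpM2l ?exprn_ge0// qM; lra.
have lowC i : (i < j)%N -> `|q`_i| <= C * ((1 + 2 ^+ j) * M).
  move=> ij; apply: le_trans (IH p _ (size_poly _ _) pM i).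
  rewrite coef_poly ij normrM ler_peMr// distrC ger0_norm.
    by rewrite lerBrDr -(natrD _ 1 1) -[X in X <= _]expr1 ler_weXn2l ?ler1n// subn_gt0.
  by rewrite subr_ge0 exprn_ege1// ler1n.
have K0 : 0 <= C * ((1 + 2 ^+ j) * M) by rewrite !mulr_ge0// addr_ge0// exprn_ge0.
move=> i; have [ij|] := ltnP i j.
  apply: le_trans (lowC i ij) _; rewrite -addn1 natrD.
  have : 0 <= j%:R * (C * ((1 + 2 ^+ j) * M)) by rewrite mulr_ge0.
  lra.
rewrite leq_eqVlt => /predU1P[<-|ji]; last first.
  rewrite nth_default ?normr0; last exact: leq_trans sq ji.
  by rewrite mulr_ge0// addr_ge0// !mulr_ge0// addr_ge0// exprn_ge0.
have -> : q`_j = q.[1] - \sum_(i < j) q`_i.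
  rewrite (horner_coef_wide _ sq) big_ord_recr /= expr1n mulr1.
  under eq_bigr do rewrite expr1n mulr1.
  by rewrite addrAC subrr add0r.
apply: le_trans (ler_normB _ _) _; rewrite mulrDl mul1r lerD ?qM//.
apply: le_trans (ler_norm_sum _ _ _) _.
apply: le_trans (_ : \sum_(k < j) C * ((1 + 2 ^+ j) * M) <= _).
  by apply: ler_sum => k _; exact: lowC.
rewrite sumr_const card_ord -[X in X <= _]mulr_natl -!mulrA ler_wpM2r//.
by rewrite ler_nat.
Qed.

Lemma poly_lipschitz0 (R : realType) (j : nat) : exists2 C : R, 0 <= C &
  forall (q : {poly R}) (M h : R), (size q <= j)%N -> 0 < h ->
    (forall z : R, 0 <= z -> z <= h -> `|q.[z]| <= M) ->
    forall z : R, 0 <= z -> z <= h -> `|q.[z] - q.[0]| <= C * M * (z / h).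
Proof.
have [C C0 CP] := coef_bound R j; exists (j%:R * C); first by rewrite mulr_ge0.
move=> q M h sq h0 qM z z0 zh.
pose p := \poly_(i < j) (q`_i * h ^+ i).
have pE s : p.[s] = q.[h * s].
  rewrite (horner_coef_wide _ sq) horner_poly.
  by apply: eq_bigr => i _; rewrite exprMn mulrA.
have pM s : 0 <= s -> s <= 1 -> `|p.[s]| <= M.
  by move=> s0 s1; rewrite pE qM ?mulr_ge0 ?(ltW h0)// ler_piMr// ltW.
have s0 : 0 <= z / h by rewrite divr_ge0 ?(ltW h0).
have s1 : z / h <= 1 by rewrite ler_pdivrMr ?mul1r.
have -> : q.[z] - q.[0] = p.[z / h] - p.[0].
  by rewrite !pE mulr0 mulrCA divff ?gt_eqF// mulr1.
rewrite !horner_poly -sumrB.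
apply: le_trans (ler_norm_sum _ _ _) _.
apply: le_trans (_ : \sum_(i < j) C * M * (z / h) <= _); last first.
  by rewrite sumr_const card_ord -[X in X <= _]mulr_natl !mulrA.
apply: ler_sum => i _; rewrite -mulrBr normrM ler_pM//.
  have := CP p M (size_poly _ _) pM i.
  by rewrite coef_poly ltn_ord.
case: (i : nat) => [|k]; first by rewrite !expr0 subrr normr0.
rewrite [0 ^+ _]expr0n subr0 normrX ger0_norm// exprS ler_piMr//.
by rewrite exprn_ile1.
Qed.

(** The approximating polynomial of degree at most j inherits the bound M + E on
    [0, h], hence has slope O((M + E) / h).  The degree N enters only through E,
    which is what makes the estimate usable for exponentially large trees. *)
Lemma log_ratio_lipschitz (R : realType) (j : nat) : exists2 C : R, 0 <= C &
  forall (p1 p2 : {poly R}) (N : nat) (l r h M E : R),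
  (size p1 <= N.+1)%N -> (size p2 <= N.+1)%N -> 0 < h -> h <= r / 2 ->
  p1.[l] != 0 -> p2.[l] != 0 ->
  (forall w : R[i], (map_poly (real_complex R) p1).[w] = 0 -> r <= normc (w - l%:C%C)) ->
  (forall w : R[i], (map_poly (real_complex R) p2).[w] = 0 -> r <= normc (w - l%:C%C)) ->
  let g z := ln (p1.[l + z] ^+ 2) - ln (p2.[l + z] ^+ 2) in
  (forall z, 0 <= z -> z <= h -> `|g z| <= M) ->
  8 * N%:R * (h / r) ^+ j.+1 <= E ->
  forall z, 0 <= z -> z <= h -> `|g z - g 0| <= (C * (M + E) + E) * (z / h).
Proof.
have [C C0 CP] := poly_lipschitz0 R j.+1; exists C => //.
move=> p1 p2 N l r h M E s1 s2 h0 hr p1l p2l f1 f2 g gM gE z z0 zh.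
have r0 : 0 < r by lra.
have [q1 sq1 q1P] := log_poly j r0 s1 p1l f1.
have [q2 sq2 q2P] := log_poly j r0 s2 p2l f2.
pose q := q1 - q2.
have sq : (size q <= j.+1)%N.
  by rewrite (leq_trans (size_polyD _ _))// geq_max sq1 size_polyN.
have err x : 0 <= x -> x <= h -> `|g x - q.[x]| <= E * (x / h) ^+ j.+1.
  move=> x0 xh; have xr : x <= r / 2 by lra.
  have -> : g x - q.[x] = (ln (p1.[l + x] ^+ 2) - q1.[x]) - (ln (p2.[l + x] ^+ 2) - q2.[x]).
    rewrite /g /q hornerD hornerN; ring.
  apply: le_trans (ler_normB _ _) _.
  apply: le_trans (_ : 8 * N%:R * (x / r) ^+ j.+1 <= _).
    have := q1P x x0 xr; have := q2P x x0 xr; lra.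
  have -> : x / r = (h / r) * (x / h) by field; rewrite !gt_eqF.
  by rewrite exprMn mulrA ler_wpM2r// exprn_ge0// divr_ge0// ltW.
have E0 : 0 <= E.
  by apply: le_trans gE; rewrite mulr_ge0 ?mulr_ge0// exprn_ge0// divr_ge0 ?(ltW h0) ?(ltW r0).
have x01 x : 0 <= x -> x <= h -> 0 <= x / h <= 1.
  by move=> x0 xh; rewrite divr_ge0 ?(ltW h0)//= ler_pdivrMr ?mul1r.
have qM x : 0 <= x -> x <= h -> `|q.[x]| <= M + E.
  move=> x0 xh; have -> : q.[x] = g x - (g x - q.[x]) by ring.
  apply: le_trans (ler_normB _ _) _; rewrite lerD ?gM//.
  apply: le_trans (err x x0 xh) _; have /andP[y0 y1] := x01 x x0 xh.
  by rewrite ler_piMr// exprn_ile1.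
have g0 : g 0 = q.[0].
  apply/eqP; rewrite -subr_eq0 -normr_le0; apply: le_trans (err 0 _ _) _ => //.
    exact: ltW.
  by rewrite mul0r exprS mul0r mulr0.
have -> : g z - g 0 = (g z - q.[z]) + (q.[z] - q.[0]) by rewrite g0; ring.
apply: le_trans (ler_normD _ _) _; rewrite mulrDl addrC lerD ?CP//.
apply: le_trans (err z z0 zh) _; have /andP[y0 y1] := x01 z z0 zh.
by rewrite ler_wpM2l// exprS ler_piMr// exprn_ile1.
Qed.

(** * The tree recursion has no 2-cycle at the critical fugacity *)

Section NoTwoCycle.
Variables (R : realType) (r : R).
Hypothesis r1 : 1 < r.

(** With r = exp(2 h), geom_sum k is r^((k-1)/2) sinh(k h) / sinh(h). *)
Definition geom_sum k : R := \sum_(i < k) r ^+ i.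
Definition geom_avg k : R := geom_sum k / k%:R.

Let r0 : 0 < r. Proof. exact: lt_trans ltr01 r1. Qed.

Lemma geom_sumE k : (r - 1) * geom_sum k = r ^+ k - 1.
Proof. by rewrite /geom_sum -subrX1. Qed.

Lemma avg_gt0 k : (0 < k)%N -> 0 < geom_avg k.
Proof.
case: k => // k _; rewrite divr_gt0 ?ltr0n// /geom_sum big_ord_recl expr0 ltr_pwDl//.
by rewrite sumr_ge0// => i _; rewrite exprn_ge0// ltW.
Qed.

(** Arithmetic-geometric inequality, pairing the exponents i and k - i. *)
Lemma geom_sum_sqr_ge k : k.+1%:R ^+ 2 * r ^+ k <= geom_sum k.+1 ^+ 2.
Proof.
have E : geom_sum k.+1 ^+ 2 = \sum_(i < k.+1) \sum_(j < k.+1) r ^+ i * r ^+ (k - j).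
  rewrite expr2 {2}/geom_sum (reindex_inj rev_ord_inj) /= big_distrlr /=.
  by under eq_bigr do under eq_bigr do rewrite subSS.
have E' : geom_sum k.+1 ^+ 2 = \sum_(i < k.+1) \sum_(j < k.+1) r ^+ j * r ^+ (k - i).
  by rewrite E exchange_big.
suff : 2 * (k.+1%:R ^+ 2 * r ^+ k) <= geom_sum k.+1 ^+ 2 + geom_sum k.+1 ^+ 2 by lra.
rewrite {1}E E' -big_split /=; under eq_bigr do rewrite -big_split /=.
apply: le_trans (_ : \sum_(i < k.+1) \sum_(j < k.+1) 2 * r ^+ k <= _).
  rewrite !sumr_const !card_ord -[X in _ <= X]mulr_natl -[X in _ <= _ * X]mulr_natl; lra.
apply: ler_sum => i _; apply: ler_sum => j _.
have ei : r ^+ i * r ^+ (k - i) = r ^+ k by rewrite -exprD subnKC// -ltnS.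
have ej : r ^+ j * r ^+ (k - j) = r ^+ k by rewrite -exprD subnKC// -ltnS.
set x := r ^+ i * r ^+ (k - j); set y := r ^+ j * r ^+ (k - i).
have x0 : 0 <= x by rewrite mulr_ge0 ?exprn_ge0 ?(ltW r0).
have y0 : 0 <= y by rewrite mulr_ge0 ?exprn_ge0 ?(ltW r0).
rewrite -(@ler_pXn2r _ 2) ?nnegrE ?mulr_ge0 ?addr_ge0 ?exprn_ge0 ?(ltW r0)//.
have -> : (2 * r ^+ k) ^+ 2 = 4 * (x * y).
  by rewrite exprMn expr2 {1}expr2 -{1}ei -ej /x /y; ring.
have := sqr_ge0 (x - y); rewrite sqrrB sqrrD; lra.
Qed.

(** Follows from geom_sum (k+1) * geom_sum (k-1) = geom_sum k ^ 2 - r ^ (k-1). *)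
Lemma avg_log_convex k : geom_avg k.+2 ^+ 2 <= geom_avg k.+3 * geom_avg k.+1.
Proof.
have E : geom_sum k.+3 * geom_sum k.+1 = geom_sum k.+2 ^+ 2 - r ^+ k.+1.
  have d0 : r - 1 != 0 by rewrite subr_eq0 gt_eqF.
  apply: (mulfI d0); apply: (mulfI d0).
  rewrite mulrBr [X in _ = X]mulrBr.
  have -> : (r - 1) * ((r - 1) * (geom_sum k.+3 * geom_sum k.+1)) =
            ((r - 1) * geom_sum k.+3) * ((r - 1) * geom_sum k.+1) by ring.
  have -> : (r - 1) * ((r - 1) * geom_sum k.+2 ^+ 2) = ((r - 1) * geom_sum k.+2) ^+ 2 by ring.
  by rewrite !geom_sumE !exprS; ring.
have g := geom_sum_sqr_ge k.+1; set a : R := k.+1%:R.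
have a0 : 0 < a by rewrite ltr0n.
have e2 : k.+2%:R = a + 1 by rewrite -addn1 natrD.
have e3 : k.+3%:R = a + 2 by rewrite -addn2 natrD.
rewrite /geom_avg e2 e3 mulf_div E expr_div_n ler_pdivrMr; last by rewrite exprn_gt0//; lra.
rewrite mulrAC ler_pdivlMr; last by rewrite mulr_gt0//; lra.
by move: g; rewrite e2 -/a; lra.
Qed.

(** Log-convexity propagates the inequality from k to k + 1; for k = 0 it says
    that r < ((1 + r) / 2)^2. *)
Lemma avg_pow_lt k : r * geom_avg k.+1 ^+ k.+3 < geom_avg k.+2 ^+ k.+2.
Proof.
elim: k => [|k IH].
  rewrite /geom_avg /geom_sum !big_ord_recr big_ord0 /= expr0 expr1 add0r divr1 expr1n mulr1.
  have := sqr_ge0 (r - 1); have : r - 1 != 0 by rewrite subr_eq0 gt_eqF.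
  rewrite -(@sqrf_eq0 _ (r - 1)) => h h'; have : 0 < (r - 1) ^+ 2 by rewrite lt_def h.
  rewrite sqrrB expr_div_n sqrrD; lra.
have m1 : 0 < geom_avg k.+1 by exact: avg_gt0.
have m2 : 0 < geom_avg k.+2 by exact: avg_gt0.
have m3 : 0 < geom_avg k.+3 by exact: avg_gt0.
rewrite -(@ltr_pM2r _ (geom_avg k.+1 ^+ k.+3)) ?exprn_gt0// -exprMn.
have h : (geom_avg k.+2 ^+ 2) ^+ k.+3 <= (geom_avg k.+3 * geom_avg k.+1) ^+ k.+3.
  apply: lerXn2r; rewrite ?nnegrE; [exact: sqr_ge0| |exact: avg_log_convex].
  by rewrite mulr_ge0 ?(ltW m1) ?(ltW m3).
apply: lt_le_trans h.
have -> : (geom_avg k.+2 ^+ 2) ^+ k.+3 = geom_avg k.+2 ^+ k.+4 * geom_avg k.+2 ^+ k.+2.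
  by rewrite -exprM -exprD; congr (_ ^+ _); lia.
rewrite mulrAC [X in _ < X]mulrC ltr_pM2r ?exprn_gt0//.
Qed.
End NoTwoCycle.

(** In terms of r = (1 + b) / (1 + a), the equation of a 2-cycle of the recursion
    determines a, and the fugacity is geom_sum d ^ d / (r geom_sum (d-1) ^ (d+1)).
    By [avg_pow_lt] this exceeds its value d^d / (d-1)^(d+1) at r = 1, so there
    is no 2-cycle at the critical fugacity. *)
Lemma two_cycle_gt (R : realType) (d : nat) (a b : R) : (1 < d)%N ->
  0 < a -> a < b -> a * (1 + b) ^+ d = b * (1 + a) ^+ d ->
  d%:R ^+ d / (d%:R - 1) ^+ d.+1 < a * (1 + b) ^+ d.
Proof.
move=> d1 a0 ab E; have [k dk] : exists k, d = k.+2 by exists d.-2; lia.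
pose r := (1 + b) / (1 + a).
have A0 : 0 < 1 + a by lra.
have r1 : 1 < r by rewrite ltr_pdivlMr// mul1r; lra.
have Bb : 1 + b = r * (1 + a) by rewrite /r divfK// gt_eqF.
have bE : b = r * (1 + a) - 1 by rewrite -Bb; ring.
clearbody r.
have d0 : r - 1 != 0 by rewrite subr_eq0 gt_eqF.
have key : a * r ^+ d = r * (1 + a) - 1.
  apply: (@mulIf _ ((1 + a) ^+ d)); first by rewrite expf_neq0 ?gt_eqF.
  by rewrite -bE -E Bb exprMn mulrA.
have G1 : a * (r * geom_sum r k.+1) = 1.
  apply: (mulfI d0).
  have -> : (r - 1) * (a * (r * geom_sum r k.+1)) = a * r * ((r - 1) * geom_sum r k.+1) by ring.
  rewrite geom_sumE; have := key; rewrite dk exprS; lra.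
have G2 : r * (1 + a) * geom_sum r k.+1 = geom_sum r d.
  apply: (mulfI d0).
  have -> : (r - 1) * (r * (1 + a) * geom_sum r k.+1) = r * (1 + a) * ((r - 1) * geom_sum r k.+1) by ring.
  rewrite !geom_sumE; have := key; rewrite dk !exprS; lra.
set l := a * (1 + b) ^+ d.
have lE : l * (r * geom_sum r k.+1 ^+ d.+1) = geom_sum r d ^+ d.
  rewrite -G2 /l Bb exprS [(r * (1 + a) * _) ^+ d]exprMn.
  by rewrite -[RHS]mul1r -G1; ring.
have gM n : (0 < n)%N -> geom_sum r n = n%:R * geom_avg r n.
  by move=> n0; rewrite /geom_avg mulrCA divff ?mulr1// pnatr_eq0 -lt0n.
have m1 : 0 < geom_avg r k.+1 by exact: avg_gt0.
have dE : d%:R - 1 = k.+1%:R :> R by rewrite dk -[k.+2]addn1 natrD addrK.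
have d0n : (0 < d)%N by rewrite dk.
rewrite dE ltr_pdivrMr ?exprn_gt0 ?ltr0n//.
rewrite -(@ltr_pM2r _ (r * geom_avg r k.+1 ^+ d.+1)) ?mulr_gt0 ?exprn_gt0//; last by lra.
have -> : l * k.+1%:R ^+ d.+1 * (r * geom_avg r k.+1 ^+ d.+1) = d%:R ^+ d * geom_avg r d ^+ d.
  by rewrite -exprMn -gM// -lE gM// [(_ * geom_avg _ _) ^+ _]exprMn; ring.
by rewrite ltr_pM2l ?exprn_gt0 ?ltr0n// dk; exact: avg_pow_lt.
Qed.

(** * Dynamics of the tree recursion *)

Lemma poly_pos_near (R : realType) (p : {poly R}) (x : R) : 0 < p.[x] ->
  exists2 e : R, 0 < e & forall y, `|y - x| <= e -> 0 < p.[y].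
Proof.
move=> px; have /cvgrPdist_lt /(_ _ px) := @continuous_horner R p x.
move=> /nbhs_ballP[e /= e0 eP]; exists (e / 2); first by rewrite divr_gt0.
move=> y yx; have : ball x e y.
  by rewrite /ball /= distrC; apply: le_lt_trans yx _; lra.
by move=> /eP /=; rewrite ltr_distlC => /andP[]; lra.
Qed.

Definition ratio_map (R : realType) (d : nat) (l x : R) : R := l / (1 + x) ^+ d.

Section RatioMap.
Variables (R : realType) (d : nat) (l : R).
Hypothesis l0 : 0 < l.
Local Notation f := (ratio_map d l).

Lemma ratio_map_gt0 x : 0 <= x -> 0 < f x.
Proof. by move=> x0; rewrite divr_gt0// exprn_gt0//; lra. Qed.

Lemma ratio_map_le x : 0 <= x -> f x <= l.
Proof.
move=> x0; rewrite ler_pdivrMr ?exprn_gt0//; last by lra.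
by rewrite ler_peMr ?(ltW l0)// exprn_ege1//; lra.
Qed.

Lemma ratio_map_anti x y : 0 <= x -> x <= y -> f y <= f x.
Proof.
move=> x0 xy; have y0 : 0 <= y by lra.
rewrite ler_pM2l// lef_pV2 ?posrE ?exprn_gt0//; try lra.
by apply: lerXn2r; rewrite ?nnegrE; lra.
Qed.

Lemma ratio_map_anti_lt x y : (0 < d)%N -> 0 <= x -> x < y -> f y < f x.
Proof.
move=> d0 x0 xy; have y0 : 0 <= y by lra.
rewrite ltr_pM2l// ltf_pV2 ?posrE ?exprn_gt0//; try lra.
by rewrite ltrXn2r ?nnegrE -?lt0n//; lra.
Qed.

Lemma ratio_map_cont (x : R) : 0 <= x -> {for x, continuous f}%classic.
Proof.
move=> x0; apply: cvgM; first exact: cvg_cst.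
apply: cvgV; first by rewrite expf_neq0// gt_eqF//; lra.
apply: (@continuous_comp _ _ _ (fun y : R => 1 + y) (fun y : R => y ^+ d)).
  by apply: cvgD; [exact: cvg_cst|exact: cvg_id].
exact: exprn_continuous.
Qed.
End RatioMap.

(** The derivative at the fixed point is - d x0 / (1 + x0), of modulus larger than
    1 under the hypothesis.  Allowing every larger l lets the same neighbourhood serve for perturbed fugacities. *)
Lemma expansion (R : realType) (d : nat) (x0 : R) : (0 < d)%N ->
  0 < x0 -> 1 < (d%:R - 1) * x0 ->
  exists delta mu : R, [/\ 0 < delta, 1 < mu & forall l y z : R,
    x0 * (1 + x0) ^+ d <= l -> `|y - x0| <= delta -> `|z - x0| <= delta ->
    mu * `|y - z| <= `|ratio_map d l y - ratio_map d l z|].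
Proof.
move=> d0 x00 sup; set l0 := x0 * (1 + x0) ^+ d.
have l00 : 0 < l0 by rewrite mulr_gt0// exprn_gt0//; lra.
pose p : {poly R} := (l0 * d%:R)%:P - ((1 + x0)%:P + 'X) ^+ d.+1.
have pE y : p.[y] = l0 * d%:R - (1 + x0 + y) ^+ d.+1 by rewrite /p !hornerE.
have p0 : 0 < p.[0].
  rewrite pE addr0 exprS /l0 subr_gt0.
  have -> : x0 * (1 + x0) ^+ d * d%:R = (d%:R * x0) * (1 + x0) ^+ d by ring.
  by rewrite ltr_pM2r ?exprn_gt0//; lra.
have [e e0 eP] := poly_pos_near p0.
pose delta := Num.min e x0.
have dl0 : 0 < delta by rewrite lt_min e0.
have dle : delta <= e by rewrite ge_min lexx.
have dlx : delta <= x0 by rewrite ge_min lexx orbT.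
have B0 : 0 < (1 + x0 + delta) ^+ d.+1 by rewrite exprn_gt0//; lra.
exists delta, (l0 * d%:R / (1 + x0 + delta) ^+ d.+1); split=> //.
  rewrite ltr_pdivlMr// mul1r -subr_gt0 -pE; apply: eP.
  by rewrite subr0 ger0_norm// ltW.
move=> l y z l0l; wlog yz : y z / y <= z.
  move=> H; have [/H//|/ltW/H h] := leP y z.
  by move=> yd zd; rewrite distrC [X in _ <= X]distrC; exact: h.
rewrite !ler_distl => /andP[y1 y2] /andP[z1 z2].
have y0 : 0 <= y by lra.
have z0 : 0 <= z by lra.
have lpos : 0 < l by exact: lt_le_trans l0l.
rewrite distrC ger0_norm ?subr_ge0// ger0_norm ?subr_ge0 ?ratio_map_anti//.
have Y0 : 0 < 1 + y by lra.
have Z0 : 0 < 1 + z by lra.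
have -> : ratio_map d l y - ratio_map d l z =
    l * ((1 + z) ^+ d - (1 + y) ^+ d) / ((1 + y) ^+ d * (1 + z) ^+ d).
  by rewrite /ratio_map; field; rewrite !expf_neq0 ?gt_eqF.
have pow : d%:R * (1 + y) ^+ d.-1 * (z - y) <= (1 + z) ^+ d - (1 + y) ^+ d.
  rewrite subrXX mulrC; have -> : 1 + z - (1 + y) = z - y by ring.
  rewrite ler_wpM2l ?subr_ge0//.
  apply: le_trans (_ : \sum_(i < d) (1 + y) ^+ d.-1 <= _).
    by rewrite sumr_const card_ord mulr_natl.
  apply: ler_sum => i _; have id : (i <= d.-1)%N by rewrite -ltnS prednK.
  rewrite -{1}(subnK id) exprD ler_wpM2r ?exprn_ge0 ?(ltW Y0)//.
  by apply: lerXn2r; rewrite ?nnegrE; lra.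
set B := 1 + x0 + delta in B0 *; have BE : B = 1 + x0 + delta by [].
have YB : 1 + y <= B by lra.
have ZB : (1 + z) ^+ d <= B ^+ d by apply: lerXn2r; rewrite ?nnegrE; lra.
have den : (1 + y) * (1 + z) ^+ d <= B ^+ d.+1.
  by rewrite exprS; apply: ler_pM => //; rewrite ?exprn_ge0; lra.
have den0 : 0 < (1 + y) * (1 + z) ^+ d by rewrite mulr_gt0 ?exprn_gt0.
apply: le_trans (_ : l * (d%:R * (1 + y) ^+ d.-1 * (z - y)) /
    ((1 + y) ^+ d * (1 + z) ^+ d) <= _); last first.
  by rewrite ler_wpM2r ?invr_ge0 ?mulr_ge0 ?exprn_ge0 ?(ltW Y0) ?(ltW Z0)// ler_wpM2l ?(ltW lpos).
have -> : l * (d%:R * (1 + y) ^+ d.-1 * (z - y)) / ((1 + y) ^+ d * (1 + z) ^+ d) =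
    l * d%:R * ((1 + y) * (1 + z) ^+ d)^-1 * (z - y).
  rewrite -[in (1 + y) ^+ d](prednK d0) exprS; field.
  by rewrite !expf_neq0 ?gt_eqF.
rewrite ler_wpM2r ?subr_ge0//; apply: ler_pM.
- by rewrite mulr_ge0// ltW.
- by rewrite invr_ge0 ltW.
- by rewrite ler_wpM2r.
- by rewrite lef_pV2 ?posrE.
Qed.

(** The fugacity is parametrised by the fixed point x of the recursion, which
    avoids solving for x.  The critical fugacity is x = 1 / (d - 1). *)
Section Orbit.
Variables (R : realType) (d : nat) (x : R).
Hypotheses (d1 : (1 < d)%N) (x0 : 0 < x).
Let l : R := x * (1 + x) ^+ d.
Local Notation f := (ratio_map d l).
Definition orbit_at k : R := iter k f l.
Local Notation u := orbit_at.

Lemma fixed_gt0 : 0 < l.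
Proof. by rewrite /l mulr_gt0// exprn_gt0// addr_gt0. Qed.
Let l0 := fixed_gt0.
Let d0 : (0 < d)%N. Proof. exact: ltnW. Qed.

Lemma ratio_map_fixed : f x = x.
Proof.
have X0 : 0 < 1 + x by rewrite addr_gt0.
by rewrite /ratio_map /l mulfK// expf_neq0// gt_eqF.
Qed.

Lemma orbit_gt0 k : 0 < u k.
Proof. by elim: k => [//|k IH]; rewrite /u iterS ratio_map_gt0// ltW. Qed.

Lemma orbit_sides k : x < u k.*2 /\ u k.*2.+1 < x.
Proof.
have next y : x < y -> f y < x.
  by move=> xy; rewrite -[X in _ < X]ratio_map_fixed; apply: ratio_map_anti_lt => //; exact: ltW.
elim: k => [|k [_ IH]].
  have h : x < u 0 by rewrite /u /= /l ltr_pMr// exprn_egt1 -?lt0n// ltrDl.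
  by split => //; exact: next h.
have h : x < u k.+1.*2.
  rewrite doubleS -[X in X < _]ratio_map_fixed; apply: ratio_map_anti_lt => //.
  exact: ltW (orbit_gt0 k.*2.+1).
by split => //; exact: next h.
Qed.

Lemma orbit_even_decr k : u k.+1.*2 <= u k.*2.
Proof.
elim: k => [|k IH].
  by apply: ratio_map_le => //; exact: ltW (orbit_gt0 1).
change (f (u k.+1.*2.+1) <= f (u k.*2.+1)).
apply: ratio_map_anti => //; first exact: ltW (orbit_gt0 k.*2.+1).
by apply: ratio_map_anti => //; exact: ltW (orbit_gt0 k.+1.*2).
Qed.

(** Even terms decrease, so they converge; by continuity the limits of the even
    and odd terms are exchanged by the recursion. *)
Lemma orbit_limit : exists a b : R,
  [/\ [/\ 0 < a, a <= x & x <= b],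
      a * (1 + b) ^+ d = l, b * (1 + a) ^+ d = l,
      forall k, b <= u k.*2
    & (u k.*2 @[k --> \oo] --> b /\ u k.*2.+1 @[k --> \oo] --> a)%classic].
Proof.
have decr : {homo (fun k => u k.*2) : n m / (n <= m)%N >-> n >= m}.
  by apply/nonincreasing_seqP => k; exact: orbit_even_decr.
have cv : cvgn (fun k => u k.*2).
  apply: nonincreasing_is_cvgn => //; exists x => _ [k _ <-].
  by rewrite ltW//; have [] := orbit_sides k.
set b := limn (fun k => u k.*2).
have ub : (u k.*2 @[k --> \oo] --> b)%classic by exact: cv.
have bu k : b <= u k.*2 by apply: nonincreasing_cvgn_ge.
have xb : x <= b.
  by apply: limr_ge => //; apply: nearW => k; rewrite ltW//; have [] := orbit_sides k.
have b0 : 0 <= b by rewrite (le_trans _ xb)// ltW.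
have a0 : 0 < f b by exact: ratio_map_gt0.
have ua : (u k.*2.+1 @[k --> \oo] --> f b)%classic.
  exact: (@continuous_cvg nat R R _ _ (fun k => u k.*2) f b (ratio_map_cont b0) ub).
have ax : f b <= x by rewrite -[X in _ <= X]ratio_map_fixed ratio_map_anti// ltW.
have fa : f (f b) = b.
  have l1 : (u k.+1.*2 @[k --> \oo] --> b)%classic.
    by rewrite (cvg_shiftS (fun k => u k.*2)).
  have l2 : (u k.+1.*2 @[k --> \oo] --> f (f b))%classic.
    exact: (@continuous_cvg nat R R _ _ (fun k => u k.*2.+1) f _ (ratio_map_cont (ltW a0)) ua).
  by rewrite -(cvg_lim (@Rhausdorff R) l2); exact: (cvg_lim (@Rhausdorff R) l1).
exists (f b), b; split => //.
- by rewrite /ratio_map divfK// expf_neq0// gt_eqF//; lra.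
- by rewrite -[X in X * _]fa {1}/ratio_map divfK// expf_neq0// gt_eqF//; lra.
Qed.

Lemma orbit_no_cycle : (d%:R - 1) * x = 1 -> (u k.*2 @[k --> \oo] --> x)%classic.
Proof.
move=> crit; have [a [b [[a0 ax xb] ab ba _ [ub _]]]] := orbit_limit.
have [eab|nab] := eqVneq a b; first by rewrite (_ : x = b)//; lra.
have lt_ab : a < b by rewrite lt_neqAle nab; lra.
have := two_cycle_gt d1 a0 lt_ab; rewrite ab ba => /(_ erefl).
have D : d%:R - 1 != 0 :> R 
  by apply/eqP => D0; move: crit; rewrite D0 mul0r => /eqP; rewrite eq_sym oner_eq0.
have xE : x = (d%:R - 1)^-1 by apply: (mulfI D); rewrite crit divff.
have XE : 1 + x = d%:R / (d%:R - 1) by rewrite xE; field.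
suff -> : l = d%:R ^+ d / (d%:R - 1) ^+ d.+1 by rewrite ltxx.
by rewrite /l XE xE expr_div_n exprS; field; rewrite expf_neq0.
Qed.

(** If the two limits coincided, the orbit would converge to the repelling fixed
    point without ever meeting it. *)
Lemma orbit_cycle : 1 < (d%:R - 1) * x ->
  exists a b : R, [/\ 0 < a, a < b, a * (1 + b) ^+ d = l, b * (1 + a) ^+ d = l
    & (forall k, b <= u k.*2) /\ (u k.*2.+1 @[k --> \oo] --> a)%classic].
Proof.
move=> sup; have [a [b [[a0 ax xb] ab ba bu [ub ua]]]] := orbit_limit.
have [eab|nab] := eqVneq a b; last first.
  by exists a, b; split => //; rewrite lt_neqAle nab; lra.
have bx : b = x by lra.
have ax' : a = x by lra.
have [dl [mu [dl0 mu1 ex]]] := expansion d0 x0 sup.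
have /cvgrPdist_le /(_ _ dl0) [n1 _ h1] := ub.
have /cvgrPdist_le /(_ _ dl0) [n2 _ h2] := ua.
rewrite bx ax' in h1 h2.
have near k : ((maxn n1 n2).*2 <= k)%N -> `|u k - x| <= dl.
  move=> nk; rewrite distrC -[k]odd_double_half; case: (odd k).
    by apply: h2 => /=; lia.
  by apply: h1 => /=; lia.
set n := (maxn n1 n2).*2.
have grow k : `|u n - x| <= `|u (k + n)%N - x|.
  elim: k => [//|k IH]; apply: le_trans IH _.
  have kn := near (k + n)%N (leq_addl _ _).
  have := ex l (u (k + n)%N) x (lexx _) kn.
  rewrite subrr normr0 => /(_ (ltW dl0)).
  rewrite ratio_map_fixed addSn -[f _]/(u (k + n).+1).
  apply: le_trans; rewrite ler_peMl// ltW//.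
have pos : 0 < `|u n - x|.
  by rewrite normr_gt0 subr_eq0 gt_eqF//; have [] := orbit_sides (maxn n1 n2).
have /cvgrPdist_lt /(_ _ pos) [m _ h] := ub.
have mm : (m <= m + maxn n1 n2)%N by exact: leq_addr.
have := h _ mm; rewrite bx distrC doubleD.
by have := grow m.*2; rewrite /n => h1' h2'; have := le_lt_trans h1' h2'; rewrite ltxx.
Qed.
End Orbit.

(** * A tree whose ratio crosses the fixed point above the critical fugacity *)

Section TreeRatio.
Variables (R : realType) (d : nat).
Hypothesis d1 : (1 < d)%N.
Local Notation tree := (tree_pair ('X : {poly R}) d).
Implicit Types (t : {poly R} * {poly R}) (l : R).

Lemma tree_pos t l : tree t -> 0 < l ->
  [/\ 0 < t.1.[l], 0 < t.2.[l] & t.2.[l] <= l * t.1.[l]].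
Proof.
move=> tt l0; elim: tt => s _ _ IH; rewrite /= hornerM hornerX !horner_prod.
have pos1 : 0 < \prod_(t <- s) t.1.[l].
  by rewrite big_seq prodr_gt0// => u /IH[].
have le12 : \prod_(t <- s) t.1.[l] <= \prod_(t <- s) (t.1 + t.2).[l].
  rewrite big_seq [X in _ <= X]big_seq; apply: ler_prod => u us; have [p0 i0 _] := IH u us.
  by rewrite hornerD (ltW p0) lerDl ltW.
by split; [exact: lt_le_trans le12|rewrite mulr_gt0|rewrite ler_wpM2l// ltW].
Qed.

Definition tree_ratio l t : R := t.2.[l] / t.1.[l].

Lemma tree_ratio_gt0 t l : tree t -> 0 < l -> 0 < tree_ratio l t.
Proof. by move=> tt l0; have [p0 i0 _] := tree_pos tt l0; rewrite divr_gt0. Qed.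

Lemma tree_ratio_le t l : tree t -> 0 < l -> tree_ratio l t <= l.
Proof. by move=> tt l0; have [p0 _ ?] := tree_pos tt l0; rewrite ler_pdivrMr. Qed.

Lemma tree_ratio_node s l : (forall t, t \in s -> tree t) -> 0 < l ->
  tree_ratio l (node_pair 'X s) = l / \prod_(t <- s) (1 + tree_ratio l t).
Proof.
move=> ts l0; rewrite /tree_ratio /= hornerM hornerX !horner_prod -mulrA; congr (_ * _).
elim: s ts => [_|t s IH ts]; first by rewrite !big_nil divr1 invr1.
rewrite !big_cons !invfM mulrACA IH; last by move=> u us; apply: ts; rewrite inE us orbT.
have [p0 i0 _] := tree_pos (ts t (mem_head _ _)) l0.
congr (_ * _); rewrite hornerD; field.
by rewrite !gt_eqF// addr_gt0.
Qed.

Definition step_pair t := node_pair 'X (nseq d t).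
Definition leaf_pair : {poly R} * {poly R} := node_pair 'X [::].

Lemma tree_leaf : tree leaf_pair. Proof. by constructor. Qed.

Lemma tree_step t : tree t -> tree (step_pair t).
Proof.
by move=> tt; constructor; rewrite ?size_nseq// => u; rewrite mem_nseq => /andP[_ /eqP ->].
Qed.

Lemma tree_iter_step k t : tree t -> tree (iter k step_pair t).
Proof. by move=> tt; elim: k => [//|k IH]; exact: tree_step. Qed.

Lemma tree_ratio_leaf l : tree_ratio l leaf_pair = l.
Proof. by rewrite /tree_ratio /leaf_pair /node_pair !big_nil /= mulr1 hornerX hornerC divr1. Qed.

Lemma tree_ratio_step t l : tree t -> 0 < l ->
  tree_ratio l (step_pair t) = ratio_map d l (tree_ratio l t).
Proof.
move=> tt l0; rewrite tree_ratio_node// => [|u]; first by rewrite big_nseq iter_mulr_1.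
by rewrite mem_nseq => /andP[_ /eqP ->].
Qed.

Lemma tree_ratio_iter k t l : tree t -> 0 < l ->
  tree_ratio l (iter k step_pair t) = iter k (ratio_map d l) (tree_ratio l t).
Proof.
move=> tt l0; elim: k => [//|k IH]; rewrite !iterS tree_ratio_step ?IH//.
exact: tree_iter_step.
Qed.

(** Up to a positive factor, l - R (1 + R)^d where R is the ratio of the tree: its
    sign compares R with the fixed point of the recursion. *)
Definition fix_poly t : {poly R} := 'X * t.1 ^+ d.+1 - t.2 * (t.1 + t.2) ^+ d.

Lemma fix_polyE t l : tree t -> 0 < l ->
  (fix_poly t).[l] = t.1.[l] ^+ d.+1 * (l - tree_ratio l t * (1 + tree_ratio l t) ^+ d).
Proof.
move=> tt l0; have [p0 _ _] := tree_pos tt l0.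
have -> : t.1.[l] ^+ d.+1 * (l - tree_ratio l t * (1 + tree_ratio l t) ^+ d) =
  l * t.1.[l] ^+ d.+1 - t.1.[l] * tree_ratio l t * (t.1.[l] * (1 + tree_ratio l t)) ^+ d.
  by rewrite exprMn exprS; ring.
have -> : t.1.[l] * tree_ratio l t = t.2.[l] by rewrite /tree_ratio mulrC divfK// gt_eqF.
have -> : t.1.[l] * (1 + tree_ratio l t) = t.1.[l] + t.2.[l].
  by rewrite mulrDr mulr1 /tree_ratio [_ * (_ / _)]mulrC divfK// gt_eqF.
by rewrite /fix_poly !hornerE.
Qed.

(** Multiplying the two equations gives
    a b ((1 + a)(1 + b))^d = x^2 (1 + x)^(2 d); if (1 + a)(1 + b) were at most
    (1 + x)^2, then a b would be at least x^2, and the arithmetic-geometric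
    inequality would give (1 + a)(1 + b) > (1 + x)^2. *)
Lemma cycle_mean_gt (a b x : R) : 0 < a -> a < b -> 0 < x ->
  a * (1 + b) ^+ d = x * (1 + x) ^+ d -> b * (1 + a) ^+ d = x * (1 + x) ^+ d ->
  (1 + x) ^+ 2 < (1 + a) * (1 + b).
Proof.
move=> a0 ab x0 ea eb; rewrite ltNge; apply/negP => le.
have b0 : 0 < b by lra.
have E : a * b * ((1 + a) * (1 + b)) ^+ d = x ^+ 2 * ((1 + x) ^+ 2) ^+ d.
  rewrite -exprM mulnC exprM expr2 -[RHS](_ : (x * (1 + x) ^+ d) * (x * (1 + x) ^+ d) = _).
    by rewrite -{1}ea -eb exprMn; ring.
  by ring.
have P0 : 0 < ((1 + x) ^+ 2) ^+ d by rewrite !exprn_gt0//; lra.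
have xab : x ^+ 2 <= a * b.
  rewrite -(ler_pM2r P0) -E ler_wpM2l ?mulr_ge0 ?(ltW a0) ?(ltW b0)//.
  by apply: lerXn2r; rewrite ?nnegrE ?sqr_ge0// mulr_ge0//; lra.
have dif : 0 < (b - a) ^+ 2 by rewrite exprn_gt0// subr_gt0.
have sum : a + b <= 2 * x by move: le xab; rewrite sqrrD; lra.
have : (a + b) ^+ 2 <= (2 * x) ^+ 2 by apply: lerXn2r; rewrite ?nnegrE; lra.
by move: dif; rewrite exprMn sqrrB sqrrD; lra.
Qed.

Lemma fixed_value_lt (x y : R) : 0 < x -> x < y -> x * (1 + x) ^+ d < y * (1 + y) ^+ d.
Proof.
move=> x0 xy; apply: ltr_pM => //; [exact: ltW|by rewrite exprn_ge0//; lra|].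
by rewrite ltrXn2r ?nnegrE -?lt0n ?(ltnW d1)//; lra.
Qed.

Lemma fix_poly_gt0 (x : R) t : tree_pair 'X d t -> 0 < x ->
  let l := x * (1 + x) ^+ d in
  tree_ratio l t < x -> 0 < (fix_poly t).[l].
Proof.
move=> tt x0 l lt; have l0 : 0 < l by exact: fixed_gt0.
rewrite fix_polyE// mulr_gt0//; first by rewrite exprn_gt0//; have [] := tree_pos tt l0.
by rewrite subr_gt0 /l fixed_value_lt// tree_ratio_gt0.
Qed.

Lemma fix_poly_lt0 (x : R) t : tree_pair 'X d t -> 0 < x ->
  let l := x * (1 + x) ^+ d in
  x < tree_ratio l t -> (fix_poly t).[l] < 0.
Proof.
move=> tt x0 l lt; have l0 : 0 < l by exact: fixed_gt0.
rewrite fix_polyE// pmulr_rlt0; last by rewrite exprn_gt0//; have [] := tree_pos tt l0.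
by rewrite subr_lt0 /l fixed_value_lt.
Qed.

Definition cross_tree m n := node_pair 'X
  (iter m.*2.+1 step_pair leaf_pair :: nseq d.-1 (iter n.*2 step_pair leaf_pair)).

Lemma tree_cross m n : tree (cross_tree m n).
Proof.
constructor; first by rewrite /= size_nseq prednK// ltnW.
move=> t; rewrite inE mem_nseq => /orP[/eqP ->|/andP[_ /eqP ->]];
  exact: tree_iter_step tree_leaf.
Qed.

Lemma tree_ratio_cross m n (x : R) : 0 < x -> let l := x * (1 + x) ^+ d in
  tree_ratio l (cross_tree m n) =
  l / ((1 + orbit_at d x m.*2.+1) * (1 + orbit_at d x n.*2) ^+ d.-1).
Proof.
move=> x0 l; have l0 : 0 < l by exact: fixed_gt0.
have it k : tree_ratio l (iter k step_pair leaf_pair) = orbit_at d x k.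
  by rewrite tree_ratio_iter ?tree_ratio_leaf//; exact: tree_leaf.
rewrite /cross_tree tree_ratio_node//; last first.
  move=> t; rewrite inE mem_nseq => /orP[/eqP ->|/andP[_ /eqP ->]];
  exact: tree_iter_step tree_leaf.
by rewrite big_cons big_nseq iter_mulr_1 !it.
Qed.

(** At lc both kinds of iterates converge to the fixed point, so for n much larger
    than m the odd iterate dominates and the ratio exceeds the fixed point.  At
    the larger fugacity ly they stay outside a 2-cycle, whose upper point then
    dominates.  The intermediate value theorem gives the crossing. *)
Lemma crossing_tree (eps : R) : 0 < eps ->
  let xc : R := (d%:R - 1)^-1 in let lc : R := xc * (1 + xc) ^+ d in
  exists t (x : R), [/\ tree t, xc < x, x * (1 + x) ^+ d < lc + eps,
    tree_ratio (x * (1 + x) ^+ d) t = x & fix_poly t != 0].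
Proof.
move=> eps0 xc lc.
have dd0 : 0 < d%:R - 1 :> R by rewrite subr_gt0 (ltr_nat _ 1).
have xc0 : 0 < xc by rewrite invr_gt0.
have lc0 : 0 < lc by exact: fixed_gt0.
pose p : {poly R} := (lc + eps)%:P - 'X * (1 + 'X) ^+ d.
have pE y : p.[y] = lc + eps - y * (1 + y) ^+ d by rewrite /p !hornerE.
have [e e0 eP] : exists2 e : R, 0 < e & forall y, `|y - xc| <= e -> 0 < p.[y].
  by apply: poly_pos_near; rewrite pE -/lc; lra.
pose y : R := xc + e.
have y0 : 0 < y by rewrite /y; lra.
have xcy : xc < y by rewrite /y; lra.
pose ly : R := y * (1 + y) ^+ d.
have lylt : ly < lc + eps.
  by rewrite -subr_gt0 -pE eP// /y [_ + e]addrC addrK ger0_norm // ltW.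
have lcy : lc < ly by exact: fixed_value_lt.
have sup : 1 < (d%:R - 1) * y by rewrite -ltr_pdivrMl// mulr1.
have [a [b [a0 ab ea eb [bu ua]]]] := orbit_cycle d1 y0 sup.
have b0 : 0 < b by lra.
have mean := cycle_mean_gt a0 ab y0 ea eb.
have yb : y <= b.
  rewrite leNgt; apply/negP => byy.
  have : (1 + a) * (1 + b) < (1 + y) ^+ 2 by rewrite expr2 ltr_pM//; lra.
  by move: mean; lra.
have B0 : 0 < (1 + b) ^+ d.-1 by rewrite exprn_gt0//; lra.
have d2 : d = d.-2.+2 by case: (d) d1 => [|[]].
have prod_gt : (1 + y) ^+ d < (1 + a) * (1 + b) ^+ d.-1.
  have -> : (1 + y) ^+ d = (1 + y) ^+ 2 * (1 + y) ^+ d.-2.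
    by rewrite {1}d2 !exprS expr0 mulr1 mulrA.
  have -> : (1 + b) ^+ d.-1 = (1 + b) * (1 + b) ^+ d.-2.
    by rewrite {1}d2 /= exprS.
  rewrite mulrA; apply: lt_le_trans (_ : (1 + a) * (1 + b) * (1 + y) ^+ d.-2 <= _).
    by rewrite ltr_pM2r// exprn_gt0//; lra.
  rewrite ler_wpM2l ?mulr_ge0//; try lra.
  by apply: lerXn2r; rewrite ?nnegrE; lra.
(* The level m is fixed first, from the orbit at the larger fugacity ly; only
   then is n chosen, from the orbit at lc, in terms of that m. *)
have [m mP] : exists m, (1 + y) ^+ d < (1 + orbit_at d y m.*2.+1) * (1 + b) ^+ d.-1.
  pose g := (1 + a) - (1 + y) ^+ d / (1 + b) ^+ d.-1.
  have g0 : 0 < g by rewrite subr_gt0 ltr_pdivrMr.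
  have /cvgrPdist_lt /(_ _ g0) [m _ h] := ua.
  exists m; rewrite -ltr_pdivrMr//; have := h m (leqnn _).
  by rewrite ltr_distlC => /andP[h1 _]; move: h1; rewrite /g; lra.
have Oc : orbit_at d xc m.*2.+1 < xc by have [] := orbit_sides d1 xc0 m.
have Op := orbit_gt0 d xc0 m.*2.+1.
have [n nP] : exists n, (1 + orbit_at d xc m.*2.+1) * (1 + orbit_at d xc n.*2) ^+ d.-1
    < (1 + xc) ^+ d.
  set O := orbit_at d xc m.*2.+1 in Oc Op *.
  pose q : {poly R} := ((1 + xc) ^+ d)%:P - (1 + O)%:P * (1 + 'X) ^+ d.-1.
  have qE z : q.[z] = (1 + xc) ^+ d - (1 + O) * (1 + z) ^+ d.-1 by rewrite /q !hornerE.
  have [e' e'0 e'P] : exists2 e' : R, 0 < e' & forall z, `|z - xc| <= e' -> 0 < q.[z].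
    apply: poly_pos_near; rewrite qE subr_gt0 -[in X in _ < X](prednK (ltnW d1)) exprS.
    by rewrite ltr_pM2r ?exprn_gt0//; lra.
  have crit : (d%:R - 1) * xc = 1 by rewrite /xc divff// gt_eqF.
  have /cvgrPdist_le /(_ _ e'0) [n _ h] := orbit_no_cycle d1 xc0 crit.
  exists n; rewrite -subr_gt0 -qE e'P// distrC; exact: h n (leqnn _).
set t := cross_tree m n; have tt : tree t by exact: tree_cross.
have Rc : xc < tree_ratio lc t.
  rewrite tree_ratio_cross// ltr_pdivlMr; last first.
    by rewrite mulr_gt0 ?exprn_gt0// ?addr_gt0// orbit_gt0.
  by rewrite /lc ltr_pM2l.
have Ry : tree_ratio ly t < y.
  have Oy := orbit_gt0 d y0 m.*2.+1; have Ey := orbit_gt0 d y0 n.*2.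
  rewrite tree_ratio_cross// ltr_pdivrMr; last first.
    by rewrite mulr_gt0 ?exprn_gt0// ?addr_gt0// orbit_gt0.
  rewrite ltr_pM2l//; apply: lt_le_trans mP _; rewrite ler_wpM2l//; first by lra.
  by apply: lerXn2r; rewrite ?nnegrE; [lra|lra|rewrite lerD2l bu].
have Wc := fix_poly_lt0 tt xc0 Rc.
have Wy := fix_poly_gt0 tt y0 Ry.
(* The root is not lc itself because fix_poly t is negative there. *)
have [|l0 /andP[l1 l2] Wl0] := @poly_ivt R (fix_poly t) lc ly (ltW lcy).
  by rewrite !ltW.
have lpos : 0 < l0 by exact: lt_le_trans l1.
pose x := tree_ratio l0 t.
have x0 : 0 < x by exact: tree_ratio_gt0.
have xl : x * (1 + x) ^+ d = l0.
  have := fix_polyE tt lpos; rewrite (eqP Wl0) => /esym/eqP; rewrite mulf_eq0.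
  have [p0 _ _] := tree_pos tt lpos.
  by rewrite expf_eq0 gt_eqF//= subr_eq0 => /eqP.
exists t, x; rewrite xl; split => //.
- rewrite ltNge; apply/negP; rewrite le_eqVlt => /predU1P[xe|lt].
    move: Wl0 Wc; rewrite -xl xe -/lc /= /poly.root => /eqP ->; by rewrite ltxx.
  have := fixed_value_lt x0 lt; rewrite xl -/lc; lra.
- exact: le_lt_trans lylt.
- by apply: contraTneq Wc => ->; rewrite horner0 ltxx.
Qed.
End TreeRatio.

(** * Instability against stability of the ratios *)

Lemma expr_small (R : realType) (q e : R) : 0 <= q -> q < 1 -> 0 < e ->
  exists n0, forall n, (n0 <= n)%N -> q ^+ n < e.
Proof.
move=> q0 q1 e0; have q1' : `|q| < 1 by rewrite ger0_norm.
have /cvgrPdist_lt /(_ _ e0) [n0 _ h] := cvg_expr q1'.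
exists n0 => n /h /=; rewrite sub0r normrN ger0_norm ?exprn_ge0//.
Qed.

(** From ln (v / u) <= v / u - 1. *)
Lemma ln_dist (R : realType) (u v U : R) : 0 < u -> u <= U -> 0 < v -> v <= U ->
  `|u - v| <= U * `|ln u - ln v|.
Proof.
move=> u0 uU v0 vU; wlog vu : u v u0 uU v0 vU / v <= u.
  move=> H; have [/H h|/ltW/H h] := leP v u; first exact: h.
  by rewrite distrC [X in _ * X]distrC; exact: h.
have U0 : 0 < U by exact: lt_le_trans uU.
have lnvu : ln v <= ln u by rewrite ler_ln.
rewrite !ger0_norm ?subr_ge0//.
have h : ln (v / u) <= v / u - 1.
  have := @le_ln1Dx R (v / u - 1); rewrite [1 + _]addrC subrK; apply.
  by rewrite ltrBrDr addNr divr_gt0.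
rewrite ln_div ?posrE// in h.
have {}h : (u - v) / u <= ln u - ln v by rewrite mulrBl divff ?gt_eqF//; lra.
rewrite ler_pdivrMr// mulrC in h; apply: le_trans h _.
by rewrite ler_wpM2r ?subr_ge0.
Qed.

Section Escape.
Variables (R : realType) (d : nat).
Hypothesis d1 : (1 < d)%N.
Local Notation tree := (tree_pair ('X : {poly R}) d).
Implicit Types (t : {poly R} * {poly R}).

(** The difference is fix_poly divided by a positive polynomial, and m is the
    multiplicity of l0 as a root of fix_poly. *)
Lemma tree_separation t (l0 : R) : tree t -> 0 < l0 -> fix_poly d t != 0 ->
  exists (m : nat) (c e : R), [/\ 0 < c, 0 < e & forall eta, 0 <= eta -> eta <= e ->
    c * eta ^+ m <= `|ratio_map d (l0 + eta) (tree_ratio (l0 + eta) t)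
                      - tree_ratio (l0 + eta) t|].
Proof.
move=> tt l00 W0.
have [m [V]] := multiplicity_XsubC (fix_poly d t) l0; rewrite W0 /= => V0 WE.
pose D := t.1 * (t.1 + t.2) ^+ d.
have Dpos l : 0 < l -> 0 < D.[l].
  move=> lpos; have [p0 i0 _] := tree_pos tt lpos.
  by rewrite /D hornerM horner_exp hornerD mulr_gt0// exprn_gt0// addr_gt0.
have V0' : V.[l0] != 0 by exact: V0.
have nV : 0 < `|V.[l0]| by rewrite normr_gt0.
(* V / D is the ratio difference divided by eta^m; c is half of its absolute
   value at l0, so it remains a lower bound nearby. *)
pose c := `|V.[l0]| / (2 * D.[l0]).
have D0 := Dpos _ l00.
have c0 : 0 < c by rewrite divr_gt0// mulr_gt0.
have [e e0 eP] : exists2 e : R, 0 < e & forall y, `|y - l0| <= e ->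
    0 < (V ^+ 2 - (c ^+ 2)%:P * D ^+ 2).[y].
  apply: poly_pos_near; rewrite hornerD hornerN hornerCM !horner_exp.
  rewrite -(real_normK (num_real V.[l0])).
  have -> : c ^+ 2 * D.[l0] ^+ 2 = `|V.[l0]| ^+ 2 / 4.
    by rewrite /c; field; rewrite gt_eqF.
  have : 0 < `|V.[l0]| ^+ 2 by rewrite exprn_gt0.
  lra.
clearbody c; exists m, c, e; split => // eta eta0 etae.
set l := l0 + eta; have lpos : 0 < l by rewrite ltr_wpDr.
have [p0 i0 _] := tree_pos tt lpos.
have Dl := Dpos _ lpos.
have -> : ratio_map d l (tree_ratio l t) - tree_ratio l t = V.[l] * eta ^+ m / D.[l].
  have -> : V.[l] * eta ^+ m = (fix_poly d t).[l].
    by rewrite WE hornerM horner_exp hornerXsubC /l addrAC subrr add0r.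
  rewrite fix_polyE// /D hornerM horner_exp hornerD.
  have -> : t.1.[l] + t.2.[l] = t.1.[l] * (1 + tree_ratio l t).
    by rewrite mulrDr mulr1 /tree_ratio [_ * (_ / _)]mulrC divfK// gt_eqF.
  have R0 := tree_ratio_gt0 tt lpos.
  rewrite /ratio_map exprMn [_ ^+ d.+1]exprS; move: R0; set r := tree_ratio l t => R0.
  by field; rewrite !expf_neq0 ?gt_eqF// addr_gt0.
rewrite !normrM normfV (ger0_norm (exprn_ge0 m eta0)) (gtr0_norm Dl).
rewrite mulrAC ler_wpM2r ?exprn_ge0// ler_pdivlMr//.
have := eP l; rewrite /l [l0 + _]addrC addrK (ger0_norm eta0) => /(_ etae).
rewrite [eta + _]addrC -/l hornerD hornerN hornerCM !horner_exp subr_gt0 => h.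
rewrite -(@ler_pXn2r _ 2) ?nnegrE ?mulr_ge0 ?(ltW c0) ?(ltW Dl)//.
by rewrite exprMn real_normK ?num_real// ltW.
Qed.

(** Consecutive ratios are compared with each other rather than with the fixed
    point, which moves with the fugacity: their distance starts at order
    theta^(k m) and grows by a factor mu as long as the orbit stays close to x. *)
Lemma tree_escape t (x : R) : tree t -> 0 < x -> 1 < (d%:R - 1) * x ->
  let l0 := x * (1 + x) ^+ d in
  fix_poly d t != 0 ->
  exists delta theta : R, [/\ 0 < delta, 0 < theta, theta < 1 &
    exists k0, forall k, (k0 <= k)%N -> exists2 i, (i <= k.+1)%N &
      delta < `|tree_ratio (l0 + theta ^+ k) (iter i (step_pair d) t) - x|].
Proof.
move=> tt x0 sup l0 W0; have l00 : 0 < l0 by exact: fixed_gt0.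
have [dl [mu [dl0 mu1 ex]]] := expansion (ltnW d1) x0 sup.
have [m [c [e [c0 e0 sep]]]] := tree_separation tt l00 W0.
(* The perturbation theta^k opens an initial gap of order theta^(k m), which k
   steps of expansion multiply by mu^k; hence the condition mu theta^m > 1. *)
have [th [th0 th1 mth]] : exists th : R, [/\ 0 < th, th < 1 & 1 < mu * th ^+ m].
  pose p : {poly R} := mu%:P * 'X ^+ m - 1.
  have pE y : p.[y] = mu * y ^+ m - 1 by rewrite /p !hornerE.
  have [a a0 aP] : exists2 a : R, 0 < a & forall y, `|y - 1| <= a -> 0 < p.[y].
    by apply: poly_pos_near; rewrite pE expr1n; lra.
  pose a' := Num.min a (1/2).
  have a'0 : 0 < a' by rewrite lt_min a0; lra.
  have a'a : a' <= a by rewrite ge_min lexx.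
  have a'h : a' <= 1/2 by rewrite ge_min lexx orbT.
  exists (1 - a'); split; [lra|lra|].
  by rewrite -subr_gt0 -pE aP// addrAC subrr add0r normrN ger0_norm// ltW.
exists dl, th; split => //.
have [k1 k1P] := expr_small (ltW th0) th1 e0.
have q0 : 0 <= (mu * th ^+ m)^-1 by rewrite invr_ge0 ltW// (lt_trans ltr01).
have q1 : (mu * th ^+ m)^-1 < 1 by rewrite invf_lt1// (lt_trans ltr01).
have e'0 : 0 < c / (2 * dl) by rewrite divr_gt0// mulr_gt0.
have [k2 k2P] := expr_small q0 q1 e'0.
exists (maxn k1 k2) => k; rewrite geq_max => /andP[kk1 kk2].
set l := l0 + th ^+ k.
pose u i := tree_ratio l (iter i (step_pair d) t).
have lpos : 0 < l by rewrite /l addr_gt0// exprn_gt0.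
apply: contrapT => no.
have near i : (i <= k.+1)%N -> `|u i - x| <= dl.
  by move=> ik; rewrite leNgt; apply/negP => h; apply: no; exists i.
have uS i : u i.+1 = ratio_map d l (u i).
  by rewrite /u iterS tree_ratio_step//; exact: tree_iter_step.
have grow i : (i <= k)%N -> mu ^+ i * (c * (th ^+ k) ^+ m) <= `|u i.+1 - u i|.
  elim: i => [_|i IH ik].
    rewrite expr0 mul1r uS; apply: sep; first by rewrite exprn_ge0// ltW.
    by rewrite ltW// k1P.
  rewrite exprS -mulrA; apply: le_trans (_ : mu * `|u i.+1 - u i| <= _).
    by rewrite ler_wpM2l ?IH// ?(ltnW ik)//; lra.
  rewrite [u i.+2]uS {3}[u i.+1]uS; apply: ex.
  - by rewrite -/l0 /l lerDl exprn_ge0// ltW.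
  - by apply: near; exact: leqW.
  - by apply: near; apply: leqW; exact: ltnW.
have g := grow k (leqnn _).
have n1 := near _ (leqnn k.+1); have n2 := near _ (leqnSn k).
have tri : `|u k.+1 - u k| <= 2 * dl.
  have -> : u k.+1 - u k = (u k.+1 - x) - (u k - x) by ring.
  by apply: le_trans (ler_normB _ _) _; lra.
have := k2P _ kk2; rewrite exprVn.
have P0 : 0 < (mu * th ^+ m) ^+ k by rewrite exprn_gt0// (lt_trans ltr01).
rewrite invf_plt ?posrE// invf_div ltr_pdivrMr// => h.
have := le_trans g tri; rewrite -exprM mulnC exprM mulrCA -exprMn; lra.
Qed.
End Escape.

Section Stability.
Variables (R : realType) (d : nat).
Hypothesis d1 : (1 < d)%N.
Local Notation tree := (tree_pair ('X : {poly R}) d).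
Local Notation C_ := (map_poly (real_complex R)).
Implicit Types (t : {poly R} * {poly R}).

Lemma size_iter_step t : exists B : nat, forall i,
  (size (iter i (step_pair d) t).1 <= B * d ^ i)%N /\
  (size ((iter i (step_pair d) t).1 + (iter i (step_pair d) t).2)%R <= B * d ^ i)%N.
Proof.
exists (maxn 1 (maxn (size t.1) (size (t.1 + t.2)%R))) => i.
set B := maxn 1 _.
have B1 : (0 < B)%N by rewrite leq_max.
elim: i => [|i [IH1 IH2]]; first by rewrite expn0 muln1 !leq_max !leqnn !orbT.
set N := (B * d ^ i)%N in IH1 IH2.
have N1 : (0 < N)%N by rewrite muln_gt0 B1 expn_gt0 ltnW.
have -> : (B * d ^ i.+1)%N = (d * N)%N by rewrite expnS mulnCA.
rewrite iterS; set o := (iter i _ _).1 in IH1 IH2 *; set oi := o + _ in IH2.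
have -> : step_pair d (iter i (step_pair d) t) = (oi ^+ d, 'X * o ^+ d).
  by rewrite /step_pair /node_pair !big_nseq !iter_mulr_1.
have pow (p : {poly R}) : (size p <= N)%N -> (size (p ^+ d) <= (d * N).-1)%N.
  move=> pN; apply: leq_trans (size_poly_exp_leq _ _) _.
  by move: (size p) pN d1 N1 => s sN dd NN; nia.
have h1 := pow _ IH2; have h2 := pow _ IH1.
have dN : (0 < d * N)%N by rewrite muln_gt0 N1 ltnW.
split; first exact: leq_trans h1 (leq_pred _).
apply: leq_trans (size_polyD _ _) _; rewrite geq_max (leq_trans h1 (leq_pred _)) /=.
apply: leq_trans (size_polyMleq _ _) _; rewrite size_polyX /=.
by rewrite -(prednK dN) ltnS.
Qed.

(** [log_ratio_lipschitz] applied to ln (1 + R)^2, on the interval [0, h] with h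
    of order tau^k. *)
Lemma tree_stable t (l0 r theta eps : R) : tree t -> 0 < l0 -> 0 < r ->
  (forall u, tree u -> forall w : R[i], (C_ u.1).[w] = 0 \/ (C_ (u.1 + u.2)).[w] = 0 ->
     r <= normc (w - l0%:C%C)) ->
  0 < theta -> theta < 1 -> 0 < eps ->
  exists k0, forall k, (k0 <= k)%N -> forall i, (i <= k.+1)%N ->
    `|tree_ratio (l0 + theta ^+ k) (iter i (step_pair d) t) - tree_ratio l0 (iter i (step_pair d) t)|
      < eps.
Proof.
move=> tt l00 r0 far th0 th1 eps0.
have dn0 : 0 < d%:R :> R by rewrite ltr0n ltnW.
(* Any tau strictly between theta and 1 would do: the interval has length
   of order tau^k, much longer than theta^k. *)
pose tau := (1 + theta) / 2.
have tau0 : 0 < tau by rewrite /tau; lra.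
have tau1 : tau < 1 by rewrite /tau; lra.
have thtau : theta < tau by rewrite /tau; lra.
have [j jP] : exists j, d%:R * tau ^+ j.+1 <= 1.
  have [|j h] := expr_small (ltW tau0) tau1 (_ : 0 < d%:R^-1 :> R); first by rewrite invr_gt0.
  by exists j; rewrite mulrC -ler_pdivlMr// mul1r ltW// h.
have [B Bsz] := size_iter_step t.
have [K K0 KP] := log_ratio_lipschitz R j.
pose U := 1 + l0 + r.
pose M := 2 * ln U.
pose E := 8 * B%:R * d%:R : R.
pose L := K * (M + E) + E.
(* U bounds 1 + R on the interval considered, M bounds the logarithm of its
   square, and E bounds the truncation error on [0, h]. *)
have U1 : 1 <= U by rewrite /U; lra.
have M0 : 0 <= M by rewrite mulr_ge0// ln_ge0.
have E0 : 0 <= E by rewrite !mulr_ge0.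
have L0 : 0 <= L by rewrite addr_ge0// mulr_ge0// addr_ge0.
have q0 : 0 <= theta / tau by rewrite divr_ge0 ?(ltW th0) ?(ltW tau0).
have q1 : theta / tau < 1 by rewrite ltr_pdivrMr// mul1r.
have r20 : 0 < r / 2 by rewrite divr_gt0.
have [k1 k1P] := expr_small q0 q1 r20.
have e'0 : 0 < eps / (U * (L + 1) / r) by rewrite !divr_gt0// !mulr_gt0//; lra.
have [k2 k2P] := expr_small q0 q1 e'0.
exists (maxn k1 k2) => k; rewrite geq_max => /andP[kk1 kk2] i ik.
set v := iter i (step_pair d) t; have tv : tree v by exact: tree_iter_step.
have [sz1 sz2] := Bsz i.
pose h := r / 2 * tau ^+ k.
have h0 : 0 < h by rewrite mulr_gt0// exprn_gt0.
have hr : h <= r / 2 by rewrite ler_piMr ?(ltW r20)// exprn_ile1 ?(ltW tau0) ?(ltW tau1).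
have pos z : 0 <= z -> 0 < l0 + z by move=> z0; rewrite ltr_wpDr.
have nz1 : v.1.[l0] != 0 by have [p0 _ _] := tree_pos tv l00; rewrite gt_eqF.
have nz2 : (v.1 + v.2).[l0] != 0.
  by have [p0 i0 _] := tree_pos tv l00; rewrite hornerD gt_eqF// addr_gt0.
have gE z : 0 <= z -> ln ((v.1 + v.2).[l0 + z] ^+ 2) - ln (v.1.[l0 + z] ^+ 2) =
    2 * ln (1 + tree_ratio (l0 + z) v).
  move=> z0; have [p0 i0 _] := tree_pos tv (pos z z0).
  have R0 := tree_ratio_gt0 tv (pos z z0).
  have -> : (v.1 + v.2).[l0 + z] = v.1.[l0 + z] * (1 + tree_ratio (l0 + z) v).
    by rewrite hornerD mulrDr mulr1 /tree_ratio [_ * (_ / _)]mulrC divfK// gt_eqF.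
  rewrite exprMn lnM ?posrE ?exprn_gt0// ?addr_gt0// addrAC subrr add0r.
  by rewrite lnXn ?addr_gt0// mulr_natl.
have RU z : 0 <= z -> z <= r -> 0 < 1 + tree_ratio (l0 + z) v <= U.
  move=> z0 zr; have R0 := tree_ratio_gt0 tv (pos z z0).
  have Rl := tree_ratio_le tv (pos z z0).
  by apply/andP; split; rewrite /U; lra.
have gM z : 0 <= z -> z <= h ->
    `|ln ((v.1 + v.2).[l0 + z] ^+ 2) - ln (v.1.[l0 + z] ^+ 2)| <= M.
  move=> z0 zh; rewrite gE//; have R0 := tree_ratio_gt0 tv (pos z z0).
  have /andP[a1 a2] : 0 < 1 + tree_ratio (l0 + z) v <= U by apply: RU => //; lra.
  rewrite ger0_norm; last by rewrite mulr_ge0// ln_ge0//; lra.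
  by rewrite ler_wpM2l// ler_ln ?posrE//; lra.
(* The degree grows like d^k and (h / r)^(j + 1) decays like tau^(k (j + 1)),
   so the choice of j keeps the product bounded. *)
have errE : 8 * (B * d ^ k.+1)%:R * (h / r) ^+ j.+1 <= E.
  have -> : h / r = 1/2 * tau ^+ k by rewrite /h; field; rewrite gt_eqF.
  rewrite natrM natrX exprMn -exprM mulnC exprM exprS.
  have a1 : (1/2 : R) ^+ j.+1 <= 1 by rewrite exprn_ile1//; lra.
  have a2 : (d%:R * tau ^+ j.+1) ^+ k <= 1.
    by rewrite exprn_ile1// mulr_ge0 ?exprn_ge0 ?(ltW tau0).
  have a3 : 0 <= (d%:R * tau ^+ j.+1) ^+ k by rewrite exprn_ge0// mulr_ge0 ?exprn_ge0 ?(ltW tau0).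
  have a0 : 0 <= (1/2 : R) ^+ j.+1 by rewrite exprn_ge0//; lra.
  have -> : 8 * (B%:R * (d%:R * d%:R ^+ k)) * ((1/2) ^+ j.+1 * (tau ^+ j.+1) ^+ k) =
     E * ((1/2) ^+ j.+1 * (d%:R * tau ^+ j.+1) ^+ k) by rewrite /E [(d%:R * _) ^+ k]exprMn; ring.
  by rewrite ler_piMr// mulr_ile1.
have szN (p : {poly R}) : (size p <= B * d ^ i)%N -> (size p <= (B * d ^ k.+1).+1)%N.
  move=> sp; apply: leqW; apply: leq_trans sp _; rewrite leq_mul2l leq_exp2l//.
  by rewrite ik orbT.
have thh : theta ^+ k <= h.
  by rewrite -ler_pdivrMr ?exprn_gt0// -expr_div_n ltW// k1P.
have thk0 : 0 <= theta ^+ k by rewrite exprn_ge0 ?(ltW th0).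
have lip := KP (v.1 + v.2) v.1 (B * d ^ k.+1)%N l0 r h M E (szN _ sz2) (szN _ sz1) h0 hr
  nz2 nz1 (fun w hw => far v tv w (or_intror hw)) (fun w hw => far v tv w (or_introl hw))
  gM errE _ thk0 thh.
rewrite /= !gE// addr0 -/L in lip.
have thr : theta ^+ k <= r by lra.
have /andP[u0 u1] := RU _ thk0 thr.
have /andP[u2 u3] := RU 0 (lexx _) (ltW r0); rewrite addr0 in u2 u3.
have := ln_dist u0 u1 u2 u3; rewrite opprD addrACA subrr add0r => dist.
apply: le_lt_trans dist _.
rewrite -mulrBr normrM normr_nat in lip.
have := k2P _ kk2; rewrite ltr_pdivlMr; last by rewrite !divr_gt0// !mulr_gt0//; lra.
have -> : (theta / tau) ^+ k * (U * (L + 1) / r) = U * ((L + 1) * (theta ^+ k / h)) / 2.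
  by rewrite /h expr_div_n; field; rewrite expf_neq0 ?gt_eqF.
apply: le_lt_trans.
rewrite -mulrA ler_wpM2l//; first by lra.
rewrite ler_pdivlMr// mulrC; apply: le_trans lip _.
by rewrite ler_wpM2r ?divr_ge0 ?(ltW h0)//; lra.
Qed.
End Stability.

(** A partition function avoiding the root is the product of the partition
    functions of the branches, so its zeros are zeros of smaller trees. *)
Lemma tree_zeros (R : realType) (d : nat) (z0 eps : R) :
  (forall (G : graph) (w : R[i]), max_degree_le d.+1 G -> indep_poly G w = 0 ->
     eps <= normc (w - z0%:C%C)) ->
  forall u, tree_pair ('X : {poly R}) d u -> forall w : R[i],
    (map_poly (real_complex R) u.1).[w] = 0 \/
    (map_poly (real_complex R) (u.1 + u.2)).[w] = 0 ->
    eps <= normc (w - z0%:C%C).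
Proof.
move=> zf.
have key u w : tree_pair ('X : {poly R}) d u ->
    (map_poly (real_complex R) (u.1 + u.2)).[w] = 0 -> eps <= normc (w - z0%:C%C).
  move=> /tree_pair_graph[G [_ mG] <-] /=; rewrite -indep_poly_root => h.
  apply: (zf G) => //; rewrite -h /indep_poly rmorph_sum horner_sum.
  by apply: eq_bigr => I _; rewrite rmorphXn /= map_polyX hornerXn.
move=> u tu w [|]; last exact: key.
case: tu => s _ ts /=; rewrite rmorph_prod horner_prod => /eqP.
by rewrite prodf_seq_eq0 => /hasP[v vs /eqP]; apply: key; exact: ts.
Qed.

(** * Zeros near the critical fugacity *)

(** Otherwise the disc around the critical fugacity is zero-free for all trees,
    and [tree_escape] contradicts [tree_stable]. *)
Lemma zeros_near_critical (R : realType) (d : nat) (eps : R) : (1 < d)%N -> 0 < eps ->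
  let xc : R := (d%:R - 1)^-1 in
  exists (G : graph) (z : R[i]), [/\ max_degree_le d.+1 G, indep_poly G z = 0
    & normc (z - (xc * (1 + xc) ^+ d)%:C%C) < eps].
Proof.
move=> d1 eps0 xc; set lc := xc * _.
apply: contrapT => no.
have zf (G : graph) (w : R[i]) : max_degree_le d.+1 G -> indep_poly G w = 0 ->
    eps <= normc (w - lc%:C%C).
  by move=> mG Gw; rewrite leNgt; apply/negP => h; apply: no; exists G, w.
have e20 : 0 < eps / 2 by rewrite divr_gt0.
have [t [x [tt xcx lx Rt W0]]] := crossing_tree d1 e20.
rewrite -/xc -/lc in xcx lx.
have dd0 : 0 < d%:R - 1 :> R by rewrite subr_gt0 (ltr_nat _ 1).
have xc0 : 0 < xc by rewrite invr_gt0.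
have x0 : 0 < x by exact: lt_trans xcx.
have sup : 1 < (d%:R - 1) * x by rewrite -ltr_pdivrMl// mulr1.
have lclt := fixed_value_lt d1 xc0 xcx; rewrite -/lc in lclt.
set l0 := x * (1 + x) ^+ d in lx Rt lclt.
have l00 : 0 < l0 by exact: fixed_gt0.
have far u : tree_pair ('X : {poly R}) d u -> forall w : R[i],
    (map_poly (real_complex R) u.1).[w] = 0 \/
    (map_poly (real_complex R) (u.1 + u.2)).[w] = 0 -> eps / 2 <= normc (w - l0%:C%C).
  move=> tu w hw; have h1 := tree_zeros zf tu hw.
  have := le_normcD (w - l0%:C%C) (l0%:C%C - lc%:C%C).
  rewrite addrA subrK -rmorphB normcR ger0_norm ?subr_ge0 ?(ltW lclt)// => h2.
  by move: h1 h2 lx; lra.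
have [dl [th [dl0 th0 th1 [k1 esc]]]] := tree_escape d1 tt x0 sup W0.
have [k2 stab] := tree_stable d1 tt l00 e20 far th0 th1 dl0.
have [i ik lt] := esc (maxn k1 k2) (leq_maxl _ _).
have := stab (maxn k1 k2) (leq_maxr _ _) i ik.
have -> : tree_ratio l0 (iter i (step_pair d) t) = x.
  rewrite tree_ratio_iter// Rt; elim: i {ik lt} => [//|i IH].
  by rewrite iterS IH ratio_map_fixed.
by move=> /(lt_trans lt); rewrite ltxx.
Qed.


Local Open Scope complex_scope.
Local Open Scope classical_set_scope.
Theorem theorem10 (R : realType)
    (ord : forall G : graph, rel G)
    (ord_total : forall G : graph, total_order (ord G))
    (phi : nat -> R)
    (phi_ge0 : forall n : nat, (0 < n)%N -> 0 <= phi n)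
    (phi_incr : forall m n : nat, (0 < m)%N -> (m <= n)%N -> phi m <= phi n)
    (phi_unbounded : forall M : R, exists n : nat, (0 < n)%N /\ M < phi n)
    (Delta : nat) (Delta_ge3 : (3 <= Delta)%N)
    (lambda_star : R) (lambda_star_gt : lambda_c R Delta < lambda_star) :
  exists F : graph -> Prop,
    [/\ forall G : graph, F G -> max_degree_le Delta G,
        forall lambda : R, 0 <= lambda -> lambda <= lambda_star ->
          VSSM ord F phi lambda
      & exists (G : nat -> graph) (lambda : nat -> R[i]),
          [/\ forall n : nat, F (G n),
              forall n : nat, indep_poly (G n) (lambda n) = 0
            & lambda n @[n --> \oo] --> ((lambda_c R Delta)%:C : (R[i])^o)]].
Proof.
apply: padded_family_of_zeros => // eps eps0.
have [d dE d1] : exists2 d, Delta = d.+1 & (1 < d)%N by exists Delta.-1; lia.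
have [G [z [mG Gz lt]]] := zeros_near_critical d1 eps0.
exists G, z; split => //; first by rewrite dE.
have nz (w : R[i]) : `|w| = (normc w)%:C%C by case: w.
rewrite nz ltcR -normcN opprB (_ : lambda_c R Delta = (d%:R - 1)^-1 * (1 + (d%:R - 1)^-1) ^+ d)//.
have dd0 : d%:R - 1 != 0 :> R by rewrite subr_eq0 (eqr_nat _ d 1) gtn_eqF.
have -> : 1 + (d%:R - 1)^-1 = d%:R / (d%:R - 1) :> R by field.
rewrite /lambda_c dE subn1 /=.
have -> : d.+1%:R - 1 = d%:R :> R by rewrite -addn1 natrD addrK.
have -> : d.+1%:R - 2 = d%:R - 1 :> R by rewrite -addn1 natrD; ring.
by rewrite expr_div_n exprS; field; rewrite expf_neq0.
Qed.
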